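(* For every $d\geq 1$ there is a constant $c_2=c_2(d)>0$ such that the following holds. Let $P=R\cup B$ be a finite bichromatic point set in $\mathbb{R}^d$ with color classes $R$ and $B$ such that $B$ surrounds $R$. Then there are nonnegative integers $a,b$ and pairwise disjoint subsets $R_1,\dots,R_a\subseteq R$ and $B_1,\dots,B_b\subseteq B$ with (1) $a+b=d+2$; (2) $|R_i|\geq c_2|R|$ for all $1\le i\le a$; (3) $|B_i|\geq c_2|R|$ for all $1\le i\le b$; (4) for every choice $r_1\in R_1,\dots,r_a\in R_a$, $b_1\in B_1,\dots,b_b\in B_b$ we have $\mathrm{conv}(r_1,\dots,r_a)\cap\mathrm{conv}(b_1,\dots,b_b)\neq\emptyset$.
   Context: $B$ surrounds $R$ means that for every closed half-space $h\subseteq\mathbb{R}^d$, $|B\cap h|\geq|R\cap h|$.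
   Formalization: The formal theorem also assumes that |R∪B| ≥ d+2 whenever R is nonempty; without it the claim fails (d=2, R={0}, B={(−1,0),(1,0)}), since d+2 pairwise disjoint nonempty subsets cannot exist. *)

(* Defs.v *)
From HB Require Import structures.
From mathcomp Require Import all_boot all_order all_algebra.
From mathcomp Require Import finmap.
From mathcomp Require Import boolp classical_sets reals convex.

Set Implicit Arguments.
Unset Strict Implicit.
Unset Printing Implicit Defensive.

Import Order.TTheory GRing.Theory Num.Theory.

Local Open Scope classical_set_scope.
Local Open Scope ring_scope.

(* The normal vector [u] must be nonzero: otherwise the empty set and the whole
   space would count as half-spaces. *)
Definition closed_halfspace (K : realType) (d : nat) (h : set 'rV[K]_d) : Prop :=
  exists (u : 'rV[K]_d) (t : K),
    u != 0 /\ h = [set x | \sum_(i < d) u 0 i * x 0 i <= t].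

Definition surrounds (K : realType) (d : nat) (B R : {fset 'rV[K]_d}) : Prop :=
  forall h : set 'rV[K]_d, closed_halfspace h ->
    (#|` [fset x in R | x \in h]%fset| <= #|` [fset x in B | x \in h]%fset|)%N.

(* The intersection of all convex sets containing [A]; in particular the hull of
   the empty set is empty. *)
Definition convex_hull (K : realType) (d : nat) (A : set 'rV[K]_d) : set 'rV[K]_d :=
  smallest (@convex_set K 'rV[K]_d) A.

(* Main.v *)
Require Import Defs.
From HB Require Import structures.
From mathcomp Require Import all_boot all_order all_algebra.
From mathcomp Require Import boolp.
From mathcomp Require Import ring lra zify.

Set Implicit Arguments.
Unset Strict Implicit.
Unset Printing Implicit Defensive.

Import Order.TTheory GRing.Theory Num.Theory.

Local Open Scope ring_scope.

(** Send a red point [r] to [(1, r)] and a blue point [b] to [-(1, b)] in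
    R^(d+1). Then conv(r_i) meets conv(b_j) iff [0] lies in the convex hull of the
    images, and [B] surrounding [R] says that every closed half-space through [0]
    contains at least [n = |R|] images. So one needs [d+2] disjoint sets of at
    least [c n] images all of whose transversals have [0] in their hull.

    Repeatedly extracting at most [d+2] vectors with [0] in their hull (Gordan and
    Caratheodory) yields O(n) vectors in which [0] still has depth of order [n],
    and a small perturbation puts them in general position. A hyperplane through
    [0] and centerpoints of [d] given sets cuts each of them in a fixed
    proportion, so [d+1] sets can be shrunk by a constant factor until, for every
    sign pattern, some hyperplane through [0] separates them accordingly; no
    hyperplane through [0] then crosses all of them. Iterating this yields
    boundedly many sets of linear size such that every closed half-space through
    [0] holding enough of the vectors contains one of them. Shrink these sets until every
    [d+1] of them are separated for all sign patterns, and pick one point in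
    each: by Gordan's alternative [0] is in the hull of these points, hence by
    Caratheodory in the hull of [d+2] of them, and by separation the coefficients
    of a vanishing combination cannot change sign when the points move within
    their sets. *)

(** * Gordan, Caratheodory and Helly *)

Lemma card_bigcup_le (I T : finType) (J : {set I}) (A : I -> {set T}) :
  (#|\bigcup_(i in J) A i| <= \sum_(i in J) #|A i|)%N.
Proof.
elim/big_rec2: _ => [|i n B _ Bn]; first by rewrite cards0.
by apply: leq_trans (leq_card_setU _ _).1 _; rewrite leq_add2l.
Qed.

Section LinearConvexity.
Variable K : realFieldType.

Definition dot (D : nat) (u v : 'rV[K]_D) : K := \sum_(i < D) u 0 i * v 0 i.

Lemma dotC D (u v : 'rV[K]_D) : dot u v = dot v u.
Proof. by apply: eq_bigr => i _; rewrite mulrC. Qed.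

Lemma dotDr D (u v w : 'rV[K]_D) : dot u (v + w) = dot u v + dot u w.
Proof. by rewrite -big_split; apply: eq_bigr => i _; rewrite mxE mulrDr. Qed.

Lemma dotZr D (u v : 'rV[K]_D) a : dot u (a *: v) = a * dot u v.
Proof. by rewrite mulr_sumr; apply: eq_bigr => i _; rewrite mxE mulrCA. Qed.

Lemma dotDl D (u v w : 'rV[K]_D) : dot (v + w) u = dot v u + dot w u.
Proof. by rewrite dotC dotDr !(dotC u). Qed.

Lemma dotZl D (u v : 'rV[K]_D) a : dot (a *: v) u = a * dot v u.
Proof. by rewrite dotC dotZr dotC. Qed.

Lemma dotNl D (u v : 'rV[K]_D) : dot (- v) u = - dot v u.
Proof. by rewrite -scaleN1r dotZl mulN1r. Qed.

Lemma dotNr D (u v : 'rV[K]_D) : dot u (- v) = - dot u v.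
Proof. by rewrite dotC dotNl dotC. Qed.

Lemma dot0r D (u : 'rV[K]_D) : dot u 0 = 0.
Proof. by rewrite -(scale0r 0) dotZr mul0r. Qed.

Lemma dot_sumr D (I : finType) (u : 'rV[K]_D) (v : I -> 'rV[K]_D) :
  dot u (\sum_i v i) = \sum_i dot u (v i).
Proof. by apply: (big_morph (dot u)) => [x y|]; rewrite ?dotDr ?dot0r. Qed.

Lemma dot_gt0 D (u : 'rV[K]_D) : u != 0 -> 0 < dot u u.
Proof.
move=> u0; rewrite lt_def sumr_ge0 ?andbT; last first.
  by move=> i _; rewrite -expr2 sqr_ge0.
apply: contra_neq u0 => /eqP; rewrite psumr_eq0; last first.
  by move=> i _; rewrite -expr2 sqr_ge0.
move=> /allP u0; apply/rowP => i; rewrite mxE.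
by have := u0 i (mem_index_enum _); rewrite mulf_eq0 orbb => /eqP.
Qed.

Lemma forall_small_pos (I : finType) (P : I -> K -> Prop) :
    (forall i, exists2 e, 0 < e & forall x, 0 < x <= e -> P i x) ->
  exists2 e, 0 < e & forall x, 0 < x <= e -> forall i, P i x.
Proof.
move=> H; have [f Hf] : exists f : I -> K,
    forall i, 0 < f i /\ forall x, 0 < x <= f i -> P i x.
  suff /choice[f Hf] : forall i, exists e, 0 < e /\ forall x, 0 < x <= e -> P i x.
    by exists f.
  by move=> i; have [e] := H i; exists e.
exists (\big[Num.min/1]_i f i).
  by apply: lt_bigmin => [|i _]; [exact: ltr01 | exact: (Hf i).1].
move=> x /andP[x0 xle] i; apply: (Hf i).2; rewrite x0 /=.
by rewrite (le_trans xle)// bigmin_le_cond.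
Qed.

Lemma add_small_pos (a b : K) : 0 < a ->
  exists2 e, 0 < e & forall x, 0 < x <= e -> 0 < a + x * b.
Proof.
move=> a0; have b1 : 0 < `|b| + 1 by rewrite ltr_pwDr.
exists (a / (`|b| + 1)); first by rewrite divr_gt0.
move=> x /andP[x0]; rewrite ler_pdivlMr// mulrDr mulr1 => xb.
have : - (x * `|b|) <= x * b by rewrite -mulrN ler_pM2l// lerNl -normrN ler_norm.
lra.
Qed.

(** The coefficients are not normalized, only their sum is positive; being indexed by all of [I] and
    zero off [J], they can be reused when [J] is enlarged. *)
Definition zero_in_hull D (I : finType) (J : {set I}) (v : I -> 'rV[K]_D) :=
  exists l : I -> K, [/\ forall i, 0 <= l i, forall i, i \notin J -> l i = 0,
    0 < \sum_i l i & \sum_i l i *: v i = 0].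

Lemma zero_in_hullS D (I : finType) (J J' : {set I}) (v : I -> 'rV[K]_D) :
  J \subset J' -> zero_in_hull J v -> zero_in_hull J' v.
Proof.
move=> /fintype.subsetP JJ' [l [l0 lJ l1 lv]]; exists l; split => // i iJ'.
by apply: lJ; apply: contra iJ' => /JJ'.
Qed.

(* Gordan's alternative, by elimination of one vector at a time: if the normal
   [w] found for the others is nonpositive on [v j], the others are projected
   along [v j] onto the hyperplane orthogonal to [w]. *)
Lemma gordan D (I : finType) (J : {set I}) (v : I -> 'rV[K]_D) :
  zero_in_hull J v \/ exists w, forall i, i \in J -> 0 < dot w (v i).
Proof.
have [n] := ubnP #|J|; elim: n => // n IH in J v *; rewrite ltnS => Jn.
have [->|/set0Pn[j jJ]] := eqVneq J set0.
  by right; exists 0 => i; rewrite inE.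
have J'n : (#|J :\ j| < n)%N by rewrite (cardsD1 j) jJ in Jn.
have [vj0|vj0] := eqVneq (v j) 0.
  left; exists (fun i => (i == j)%:R); split.
  - by move=> i; rewrite ler0n.
  - by move=> i; have [->|//] := eqVneq i j; rewrite jJ.
  - by rewrite (bigD1 j)//= eqxx big1 ?addr0 ?ltr01// => i /negPf->.
  - rewrite (bigD1 j)//= vj0 scaler0 add0r big1// => i /negPf->.
    by rewrite scale0r.
(* A normal vanishing on [v j] and positive on the other vectors becomes positive on all of them
   after adding a small multiple of [v j]. *)
have orth w : dot w (v j) = 0 -> (forall i, i \in J :\ j -> 0 < dot w (v i)) ->
    exists w, forall i, i \in J -> 0 < dot w (v i).
  move=> wj wi.
  have [i|e e0 He] := @forall_small_pos I (fun i x => i \in J :\ j ->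
      0 < dot w (v i) + x * dot (v j) (v i)).
    case: (boolP (i \in J :\ j)) => [/wi iJ|_]; last by exists 1.
    by have [e e0 He] := add_small_pos (dot (v j) (v i)) iJ; exists e => // x /He.
  exists (w + e *: v j) => i iJ; rewrite dotDl dotZl.
  have [->|ij] := eqVneq i j; first by rewrite wj add0r mulr_gt0// dot_gt0.
  by apply: He; rewrite ?lexx ?e0// !inE ij.
have [H|[w Hw]] := IH (J :\ j) v J'n.
  by left; apply: zero_in_hullS H; apply: subD1set.
have [wj|wj|wj] := ltgtP 0 (dot w (v j)).
- right; exists w => i iJ; have [->//|ij] := eqVneq i j.
  by apply: Hw; rewrite !inE ij.
- pose b i := dot w (v i) / dot w (v j).
  have [[l [l0 lJ l1 lv]]|[w' Hw']] := IH (J :\ j) (fun i => v i - b i *: v j) J'n.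
    left; pose c := - \sum_i l i * b i.
    have c0 : 0 <= c.
      rewrite oppr_ge0; apply: sumr_le0 => i _.
      have [iJ|iJ] := boolP (i \in J :\ j); last by rewrite lJ ?mul0r.
      apply: mulr_ge0_le0 => //; apply: mulr_ge0_le0; first exact/ltW/Hw.
      by rewrite invr_le0 ltW.
    exists (fun i => l i + (i == j)%:R * c); split.
    + by move=> i; rewrite addr_ge0// mulr_ge0.
    + move=> i iJ; rewrite lJ ?inE ?(negPf iJ) ?andbF//.
      by have [E|] := eqVneq i j; [rewrite E jJ in iJ | rewrite mul0r addr0].
    + rewrite big_split /= ltr_wpDr// sumr_ge0// => i _.
      by rewrite mulr_ge0.
    + rewrite -[RHS]lv; under eq_bigr do rewrite scalerDl.
      under [RHS]eq_bigr do rewrite scalerBr scalerA.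
      rewrite !big_split /=; congr (_ + _).
      rewrite (bigD1 j)//= eqxx mul1r big1 ?addr0; last first.
        by move=> i /negPf->; rewrite mul0r scale0r.
      by rewrite sumrN -scaler_suml /c scaleNr.
  (* This normal is orthogonal to [v j] and takes on [v i] the value of [w'] on the projected
     vector. *)
  right; apply: (orth (w' - (dot w' (v j) / dot w (v j)) *: w)).
    by rewrite dotDl dotNl dotZl divfK ?subrr// lt_eqF.
  move=> i /Hw'; rewrite dotDr dotNr dotZr dotDl dotNl dotZl /b.
  rewrite [dot w (v i) / _ * _]mulrAC [dot w' (v j) / _ * _]mulrAC.
  by rewrite [dot w (v i) * _]mulrC.
- by right; apply: (orth w).
Qed.

Lemma linear_dependence D (I : finType) (J : {set I}) (p : I -> 'rV[K]_D) :
    (D < #|J|)%N ->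
  exists m : I -> K, [/\ forall i, i \notin J -> m i = 0,
    exists i, m i != 0 & \sum_i m i *: p i = 0].
Proof.
move=> DJ; have /card_gt0P[i0 i0J] : (0 < #|J|)%N by apply: leq_ltn_trans DJ.
pose A := \matrix_(k < #|J|) p (enum_val k).
have : kermx A != 0.
  rewrite -mxrank_eq0 mxrank_ker -lt0n subn_gt0.
  exact: leq_ltn_trans (rank_leq_col A) DJ.
move=> /rowV0Pn[x /sub_kermxP xA x0].
exists (fun i => if i \in J then x 0 (enum_rank_in i0J i) else 0); split.
- by move=> i /negPf->.
- have /rV0Pn[k xk] := x0; exists (enum_val k).
  by rewrite enum_valP enum_valK_in.
- rewrite (bigID (mem J)) /= [X in _ + X]big1 ?addr0; last first.
    by move=> i /negPf->; rewrite scale0r.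
  rewrite -[RHS]xA mulmx_sum_row big_enum_val /=.
  by apply: eq_bigr => k _; rewrite enum_valP enum_valK_in rowK.
Qed.

(** Appending a coordinate 1 makes the zero sum of the coefficients part of a linear dependence;
    coefficients of sum zero that are not all zero include a positive one. *)
Lemma affine_dependence D (I : finType) (J : {set I}) (p : I -> 'rV[K]_D) :
    (D.+1 < #|J|)%N ->
  exists m : I -> K, [/\ forall i, i \notin J -> m i = 0,
    exists i, 0 < m i, \sum_i m i = 0 & \sum_i m i *: p i = 0].
Proof.
rewrite -(addn1 D) => DJ.
have [m [mJ [i mi] mp]] :=
  linear_dependence (fun i => row_mx (p i) (const_mx 1 : 'rV_1)) DJ.
have m1 : \sum_i m i = 0.
  have /(congr1 rsubmx)/(congr1 (fun x : 'M_1 => x 0 0)) := mp.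
  rewrite raddf_sum summxE linear0 mxE => m0; rewrite -[RHS]m0.
  apply: eq_bigr => k _.
  by rewrite /= scale_row_mx row_mxKr !mxE mulr1.
have mp' : \sum_i m i *: p i = 0.
  have /(congr1 lsubmx) := mp; rewrite raddf_sum linear0 => m0.
  by rewrite -[RHS]m0; apply: eq_bigr => k _; rewrite /= scale_row_mx row_mxKl.
exists m; split => //.
apply: contrapT => /forallNP mle; have /eqP := m1.
have m0 k : m k <= 0 by rewrite leNgt; apply/negP/mle.
rewrite -oppr_eq0 -sumrN psumr_eq0; last by move=> k _; rewrite oppr_ge0.
by move=> /allP/(_ i (mem_index_enum _)); rewrite oppr_eq0 (negPf mi).
Qed.

(** An affine dependence is subtracted with the largest factor that keeps all coefficients
    nonnegative; this kills one of them and leaves their sum unchanged. *)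
Lemma caratheodory D (I : finType) (J : {set I}) (v : I -> 'rV[K]_D) :
  zero_in_hull J v ->
  exists J' : {set I}, [/\ J' \subset J, (#|J'| <= D.+1)%N & zero_in_hull J' v].
Proof.
have [n] := ubnP #|J|; elim: n => // n IH in J *; rewrite ltnS => Jn Jv.
have [JD|JD] := leqP #|J| D.+1; first by exists J.
have [m [mJ [i0 mi0] m1 mv]] := affine_dependence v JD.
have [l [l0 lJ l1 lv]] := Jv.
have [i mi imin] := @Order.TotalTheory.arg_minP _ K I i0 (fun i => 0 < m i)
  (fun i => l i / m i) mi0.
have iJ : i \in J by apply: contraTT mi => /mJ->; rewrite ltxx.
pose t := l i / m i; have t0 : 0 <= t by rewrite divr_ge0// ltW.
have J'v : zero_in_hull (J :\ i) v.
  exists (fun k => l k - t * m k); split.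
  - move=> k; rewrite subr_ge0; have [mk|mk] := ltP 0 (m k).
      by rewrite -ler_pdivlMr// imin.
    by rewrite (le_trans _ (l0 k))// mulr_ge0_le0.
  - move=> k; rewrite !inE negb_and negbK => /orP[/eqP->|kJ].
      by rewrite /t divfK ?subrr ?gt_eqF.
    by rewrite lJ// mJ// mulr0 subrr.
  - by rewrite big_split /= sumrN -mulr_sumr m1 mulr0 subr0.
  - under eq_bigr do rewrite scalerBl -scalerA.
    by rewrite big_split /= sumrN -scaler_sumr mv scaler0 subr0.
have [|J' [J'J J'D HJ']] := IH (J :\ i) _ J'v.
  by rewrite (cardsD1 i) iJ in Jn.
by exists J'; split => //; apply: subset_trans J'J (subD1set _ _).
Qed.

(** Radon's argument: [p j] lies in every [C i] with [i] other than [j], and an affine dependence of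
    the [p j] writes one point as a combination over the positive and over the negative indices; for
    each [i] one of the two avoids [p i]. *)
Lemma helly D (I : finType) (C : I -> 'rV[K]_D -> Prop) :
    (forall i (l : I -> K) (p : I -> 'rV[K]_D), (forall j, 0 <= l j) ->
       \sum_j l j = 1 -> (forall j, 0 < l j -> C i (p j)) ->
       C i (\sum_j l j *: p j)) ->
  forall J : {set I},
    (forall J' : {set I}, J' \subset J -> (#|J'| <= D.+1)%N ->
       exists x, forall i, i \in J' -> C i x) ->
  exists x, forall i, i \in J -> C i x.
Proof.
move=> Cconv J; have [n] := ubnP #|J|; elim: n => // n IH in J *.
rewrite ltnS => Jn HJ.
have [JD|JD] := leqP #|J| D.+1; first exact: HJ.
have [p Hp] : exists p : I -> 'rV[K]_D,
    forall j, j \in J -> forall i, i \in J :\ j -> C i (p j).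
  suff /choice[p Hp] : forall j, exists x : 'rV[K]_D,
      j \in J -> forall i, i \in J :\ j -> C i x by exists p.
  move=> j; have [jJ|jJ] := boolP (j \in J); last by exists 0.
  have [||x Hx] := IH (J :\ j); last by exists x.
    by rewrite (cardsD1 j) jJ in Jn.
  by move=> J' J'J; apply: HJ; apply: subset_trans J'J (subD1set _ _).
have [m [mJ [i0 mi0] m1 mp]] := affine_dependence p JD.
pose pos j := if 0 < m j then m j else 0.
pose neg j := if m j < 0 then - m j else 0.
have posB j : pos j - neg j = m j by rewrite /pos /neg; case: (ltgtP 0 (m j)) => *; lra.
have pos_ge0 j : 0 <= pos j by rewrite /pos; case: ltP => // /ltW.
have neg_ge0 j : 0 <= neg j by rewrite /neg; case: ifP => //; rewrite oppr_ge0 => /ltW.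
pose s := \sum_j pos j.
have s_gt0 : 0 < s.
  rewrite /s (bigD1 i0)//= ltr_pwDl// /pos ?mi0//.
  by rewrite sumr_ge0// => j _; apply: pos_ge0.
have sneg : s = \sum_j neg j.
  apply/eqP; rewrite -subr_eq0 -sumrB; apply/eqP.
  by under eq_bigr do rewrite posB.
have pneg : \sum_j (pos j / s) *: p j = \sum_j (neg j / s) *: p j.
  apply/eqP; rewrite -subr_eq0 -sumrB; apply/eqP.
  under eq_bigr do rewrite -scalerBl -mulrBl posB mulrC -scalerA.
  by rewrite -scaler_sumr mp scaler0.
have inJ j : m j != 0 -> j \in J by apply: contraNT => /mJ->.
exists (\sum_j (pos j / s) *: p j) => i iJ.
have [mi|mi] := ltP 0 (m i).
- rewrite pneg; apply: Cconv => [j||j].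
  + by rewrite divr_ge0// ltW.
  + by rewrite -mulr_suml -sneg divff// gt_eqF.
  + rewrite pmulr_lgt0 ?invr_gt0// /neg; case: ifP => [mj _|]; last by rewrite ltxx.
    apply: Hp; first by rewrite inJ ?lt_eqF.
    by rewrite !inE iJ andbT; apply: contraTneq mj => <-; rewrite -leNgt ltW.
- apply: Cconv => [j||j].
  + by rewrite divr_ge0// ltW.
  + by rewrite -mulr_suml divff// gt_eqF.
  + rewrite pmulr_lgt0 ?invr_gt0// /pos; case: ifP => [mj _|]; last by rewrite ltxx.
    apply: Hp; first by rewrite inJ ?gt_eqF.
    by rewrite !inE iJ andbT; apply: contraTneq mj => <-; rewrite -leNgt.
Qed.

(* Helly is applied to the sets of points that no open half-space separates
   from [Y], where [Y] ranges over the large subsets of [X]. *)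
Lemma centerpoint D (T : finType) (X : {set T}) (v : T -> 'rV[K]_D) :
  exists p, forall u,
    (#|X| <= D.+1 * #|[set x in X | (dot u p <= dot u (v x))%R]|)%N.
Proof.
have [->|X0] := eqVneq X set0; first by exists 0 => u; rewrite cards0.
pose C (Y : {set T}) (p : 'rV[K]_D) :=
  forall u, exists2 y, y \in Y & dot u p <= dot u (v y).
(* Members of [J] miss less than a fraction 1/(D+1) of [X], so any D+1 of them share a point of
   [X]. *)
pose J := [set Y : {set T} | (Y \subset X) && (D.+1 * #|X :\: Y| < #|X|)%N].
have [||p Hp] := @helly D _ C _ J.
- move=> Y l p l0 l1 Cp u.
  suff [j lj pj] : exists2 j, 0 < l j & dot u (\sum_j l j *: p j) <= dot u (p j).
    by have [y yY py] := Cp j lj u; exists y => //; apply: le_trans pj py.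
  apply: contrapT => /forall2NP H; set q := \sum_j _ in H.
  have Hle j : 0 <= l j * (dot u q - dot u (p j)).
    have [->|lj] := eqVneq (l j) 0; first by rewrite mul0r.
    have [/negP|] := H j; first by rewrite lt_def lj l0.
    by move=> /negP; rewrite -ltNge => /ltW pq; rewrite mulr_ge0// subr_ge0.
  have : \sum_j l j * (dot u q - dot u (p j)) = 0.
    under eq_bigr do rewrite mulrBr.
    rewrite sumrB -mulr_suml l1 mul1r {1}/q dot_sumr.
    by under eq_bigr do rewrite dotZr; rewrite subrr.
  move=> /eqP; rewrite psumr_eq0// => /allP Hz.
  have : \sum_j l j == 0.
    rewrite psumr_eq0//; apply/allP => j jI; have := Hz j jI.
    rewrite mulf_eq0 => /orP[//|]; rewrite subr_eq0 => /eqP qj.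
    have [/negP|/negP] := H j; last by rewrite qj lexx.
    by rewrite lt_def l0 andbT negbK.
  by rewrite l1 oner_eq0.
- move=> J' /fintype.subsetP J'J J'D.
  suff [x Hx] : exists x, forall Y, Y \in J' -> x \in Y.
    by exists (v x) => Y YJ u; exists x; rewrite ?Hx.
  have [x xX xn] : exists2 x, x \in X & x \notin \bigcup_(Y in J') (X :\: Y).
    apply/subsetPn/negP => /subset_leq_card XU.
    have {XU}: (#|X| <= \sum_(Y in J') #|X :\: Y|)%N.
      exact: leq_trans XU (card_bigcup_le _ _).
    have [->|[Y0 Y0J]] := set_0Vmem J'.
      by rewrite big_set0 leqn0 cards_eq0 (negPf X0).
    rewrite leqNgt => /negP; apply.
    rewrite -(ltn_pmul2l (ltn0Sn D)) big_distrr /=.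
    apply: (@leq_trans (\sum_(Y in J') #|X|)); last first.
      by rewrite sum_nat_const leq_mul2r J'D orbT.
    rewrite [X in (X < _)%N](bigD1 Y0)//= [X in (_ < X)%N](bigD1 Y0)//=.
    rewrite -addSn leq_add//; first by have := J'J _ Y0J; rewrite inE => /andP[].
    apply: leq_sum => Y /andP[/J'J]; rewrite inE => /andP[_ /ltnW //].
  exists x => Y YJ; apply: contraNT xn => xY; apply/bigcupP; exists Y => //.
  by rewrite inE xY.
exists p => u; rewrite leqNgt; apply/negP => Hlt.
have [|y] := Hp [set x in X | dot u (v x) < dot u p] _ u.
  rewrite inE; apply/andP; split.
    by apply/fintype.subsetP => x; rewrite inE => /andP[].
  suff -> : X :\: [set x in X | dot u (v x) < dot u p] =
      [set x in X | dot u p <= dot u (v x)] by [].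
  by apply/setP => x; rewrite !inE; case: (x \in X); rewrite ?andbF ?andbT//= leNgt.
by rewrite inE leNgt => /andP[_ ->].
Qed.

End LinearConvexity.

(** * Perturbation into general position *)

Lemma subset_of_card (T : finType) (J : {set T}) k :
  (k <= #|J|)%N -> exists2 J' : {set T}, J' \subset J & #|J'| = k.
Proof.
move=> kJ; exists [set x in take k (enum J)].
  by apply/fintype.subsetP => x; rewrite inE => /mem_take; rewrite mem_enum.
rewrite cardsE (card_uniqP _) ?take_uniq ?enum_uniq// size_takel//.
by rewrite -cardE.
Qed.

Lemma superset_of_card (T : finType) (J : {set T}) k :
  (#|J| <= k <= #|T|)%N -> exists2 J' : {set T}, J \subset J' & #|J'| = k.
Proof.
move=> /andP[Jk kT].
have [|J' J'J J'k] := @subset_of_card T (~: J) (k - #|J|).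
  by rewrite [#|~: J|]cardsCs setCK leq_sub2r.
exists (J :|: J'); first exact: subsetUl.
rewrite cardsU J'k (_ : J :&: J' = set0) ?cards0 ?subn0 ?subnKC//.
by apply/eqP; rewrite setI_eq0 disjoint_sym disjoints_subset.
Qed.

Section Perturbation.
Variable K : realFieldType.

Definition general_position D (T : finType) (v : T -> 'rV[K]_D) :=
  forall (J : {set T}) (m : T -> K), (#|J| <= D)%N ->
    (forall i, i \notin J -> m i = 0) -> \sum_i m i *: v i = 0 ->
  forall i, m i = 0.

Lemma zero_in_hull_dot D (I : finType) (v : I -> 'rV[K]_D) w :
  (forall i, 0 < dot w (v i)) -> ~ zero_in_hull [set: I] v.
Proof.
move=> Hw [l [l0 _ l1 lv]].
have: \sum_i l i * dot w (v i) = 0.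
  under eq_bigr do rewrite -dotZr.
  by rewrite -dot_sumr lv dot0r.
move=> /eqP; rewrite psumr_eq0; last by move=> i _; rewrite mulr_ge0// ltW.
move=> /allP Hz; move: l1; rewrite big1 ?ltxx// => i _.
have := Hz i (mem_index_enum _).
by rewrite mulf_eq0 [X in _ || X]gt_eqF// orbF => /eqP.
Qed.

(** As long as fewer than [n] vectors are removed, the rest has [0] in its hull, since otherwise
    some closed half-space would hold only removed vectors. Each round removes a Caratheodory
    subset, which meets every closed half-space through [0], so the depth grows by one. *)
Lemma extraction D (T : finType) (v : T -> 'rV[K]_D) n :
    (forall w, n <= #|[set i | (0 <= dot w (v i))%R]|)%N ->
  forall k, (D.+1 * k < n + D.+1)%N ->
  exists W : {set T}, (#|W| <= D.+1 * k)%N /\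
    forall w, (k <= #|[set i in W | (0 <= dot w (v i))%R]|)%N.
Proof.
move=> Hn; elim=> [|k IH] kn; first by exists set0; rewrite cards0.
have [|W [Wk HW]] := IH; first by rewrite mulnS in kn; lia.
have [H|[w Hw]] := gordan (~: W) v; last first.
  have /subset_leq_card : [set i | (0 <= dot (- w) (v i))%R] \subset W.
    apply/fintype.subsetP => i; rewrite inE; apply: contraTT => iW.
    by rewrite dotNl oppr_ge0 -ltNge Hw// inE.
  by have := Hn (- w); rewrite mulnS in kn; lia.
have [J [JW JD [l [l0 lJ l1 lv]]]] := caratheodory H.
exists (W :|: J); split.
  by apply: leq_trans (leq_card_setU _ _).1 _; rewrite mulnS; lia.
move=> w; have [j jJ jw] : exists2 j, j \in J & 0 <= dot w (v j).
  apply: contrapT => /forall2NP Hlt.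
  have: \sum_i l i * dot (- w) (v i) = 0.
    under eq_bigr do rewrite -dotZr.
    by rewrite -dot_sumr lv dot0r.
  move=> /eqP; rewrite psumr_eq0; last first.
    move=> i _; have [/negP iJ|/negP] := Hlt i; first by rewrite lJ ?mul0r.
    by rewrite -ltNge => /ltW wi; rewrite mulr_ge0// dotNl oppr_ge0.
  move=> /allP Hz; move: l1; rewrite big1 ?ltxx// => i _.
  have := Hz i (mem_index_enum _); rewrite mulf_eq0 => /orP[/eqP//|/eqP iw].
  have [/negP iJ|/negP] := Hlt i; first by rewrite lJ.
  by rewrite -oppr_le0 -dotNl iw lexx.
have jW : j \notin W by have := fintype.subsetP JW j jJ; rewrite inE.
apply: (@leq_trans #|j |: [set i in W | (0 <= dot w (v i))%R]|).
  by rewrite cardsU1 !inE (negPf jW) /= add1n ltnS.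
apply/subset_leq_card/fintype.subsetP => i; rewrite !inE.
by move=> /orP[/eqP->|/andP[-> ->//]]; rewrite jJ orbT.
Qed.

Lemma exists_small_nonroot (q : {poly K}) e0 :
  q != 0 -> 0 < e0 -> exists2 e, 0 < e <= e0 & ~~ root q e.
Proof.
(* There are [size q] distinct candidates, more than [q] has roots. *)
move=> q0 e0_gt0; pose rs := [seq e0 / i.+1%:R | i <- iota 0 (size q)].
have : ~~ all (root q) rs.
  apply: contraL (leqnn (size q)) => Hall; rewrite -ltnNge.
  have := max_poly_roots q0 Hall; rewrite size_map size_iota; apply.
  rewrite map_inj_uniq ?iota_uniq// => i j.
  move=> /(mulfI (lt0r_neq0 e0_gt0))/invr_inj/eqP.
  by rewrite eqr_nat => /eqP[].
move=> /allPn[_ /mapP[i _ ->] Hr]; exists (e0 / i.+1%:R) => //.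
by rewrite divr_gt0 ?ltr0n//= ler_pdivrMr ?ltr0n// ler_peMr ?ler1n ?ltW.
Qed.

Lemma Vandermonde_unit D (a : 'I_D -> K) :
  injective a -> Vandermonde D (\row_j a j) \in unitmx.
Proof.
move=> ai; rewrite unitmxE det_Vandermonde unitfE.
apply/prodf_neq0 => i _; apply/prodf_neq0 => j ij.
by rewrite !mxE subr_eq0; apply: contraTneq ij => /ai->; rewrite ltnn.
Qed.

(* Each vector is replaced by [d.+2] nearby ones, displaced along signed points
   of the moment curve; the signs are chosen so that the displacements have [0]
   in their convex hull, hence a closed half-space containing the vector still
   contains one of its copies. *)
Lemma perturbation d (T : finType) (v : T -> 'rV[K]_d.+1) L :
  exists v' : T * 'I_d.+2 -> 'rV[K]_d.+1,
    [/\ general_position v',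
        forall w i, 0 <= dot w (v i) -> exists a, 0 <= dot w (v' (i, a))
      & forall y : {ffun 'I_L -> T * 'I_d.+2},
          zero_in_hull [set: 'I_L] (fun i => v' (y i)) ->
          zero_in_hull [set: 'I_L] (fun i => v (y i).1)].
Proof.
pose T' : finType := (T * 'I_d.+2)%type.
pose t (x : T') : K := (enum_rank x)%:R.
have t_inj : injective t.
  by move=> x y /eqP; rewrite eqr_nat => /eqP/ord_inj/enum_rank_inj.
(* The moment curve starts with exponent 0, so any d+1 of these points are linearly independent by
   Vandermonde. *)
pose g (x : T') : 'rV[K]_d.+1 := \row_(j < d.+1) t x ^+ j.
have [m Hm] : {m : T -> 'I_d.+2 -> K | forall i,
    (exists a, m i a != 0) /\ \sum_a m i a *: g (i, a) = 0}.
  apply: cid.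
  suff /choice[m Hm] : forall i, exists m : 'I_d.+2 -> K,
    (exists a, m a != 0) /\ \sum_a m a *: g (i, a) = 0 by exists m.
  move=> i; have [|m [_ m0 mg]] :=
      @linear_dependence K _ _ [set: 'I_d.+2] (fun a => g (i, a)).
    by rewrite cardsT card_ord.
  by exists m.
(* The displacements [s x *: g x] of the copies of one vector, weighted by the absolute values of
   [m], sum to zero. *)
pose s (x : T') : K := if m x.1 x.2 < 0 then -1 else 1.
have s0 x : s x != 0 by rewrite /s; case: ifP; rewrite ?oppr_eq0 oner_eq0.
pose v' (e : K) (x : T') := v x.1 + (e * s x) *: g x.
have [e0 e0_gt0 He0] : exists2 e, 0 < e & forall x, 0 < x <= e ->
    forall y : {ffun 'I_L -> T'},
          zero_in_hull [set: 'I_L] (fun i => v' x (y i)) ->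
          zero_in_hull [set: 'I_L] (fun i => v (y i).1).
  apply: (@forall_small_pos K {ffun 'I_L -> T'} (fun y x =>
    zero_in_hull [set: 'I_L] (fun i => v' x (y i)) ->
    zero_in_hull [set: 'I_L] (fun i => v (y i).1))) => y.
  have [H|[w Hw]] := gordan [set: 'I_L] (fun i => v (y i).1); first by exists 1.
  have [i|e e0 He] := @forall_small_pos K 'I_L (fun i x =>
      0 < dot w (v (y i).1) + x * (s (y i) * dot w (g (y i)))).
    by apply: add_small_pos; apply: Hw; rewrite inE.
  exists e => // x /He Hx /(@zero_in_hull_dot _ _ _ w)[] i.
  by rewrite /v' dotDr dotZr -mulrA.
pose A (f : {ffun 'I_d.+1 -> T'}) := \matrix_k v (f k).1.
pose G (f : {ffun 'I_d.+1 -> T'}) := \matrix_k (s (f k) *: g (f k)).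
have GU (f : {ffun 'I_d.+1 -> T'}) : injective f -> G f \in unitmx.
  move=> fi.
  have -> : G f = diag_mx (\row_k s (f k)) *m
      (Vandermonde d.+1 (\row_j t (f j)))^T.
    by apply/matrixP => i j; rewrite mul_diag_mx !mxE.
  rewrite unitmx_mul unitmx_tr Vandermonde_unit ?andbT; last exact: inj_comp.
  rewrite unitmxE det_diag unitfE; apply/prodf_neq0 => i _.
  by rewrite mxE.
(* For injective [f], the rows of [A f + e *: G f] are dependent exactly when [e] is an eigenvalue
   of [B f], so [e] only has to avoid finitely many roots. *)
pose B f := - (A f *m invmx (G f)).
have [|e /andP[e_gt0 ee0]] :=
  @exists_small_nonroot (\prod_(f : {ffun 'I_d.+1 -> T'}) char_poly (B f)) e0 _ e0_gt0.
  by apply/prodf_neq0 => f _; rewrite monic_neq0// char_poly_monic.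
rewrite /root horner_prod => /prodf_neq0 Hroot.
exists (v' e); split; last by apply: He0; rewrite e_gt0.
(* Either there are no copies at all or at least d+1 of them, so [J] can be enlarged to exactly d+1
   indices. *)
- have TD : (d.+1 <= #|T'|)%N \/ forall x : T', False.
    have [T0|T0] := eqVneq #|T| 0%N.
      right=> -[i _]; have := max_card (pred1 i); by rewrite card1 T0.
    by left; rewrite /T' card_prod card_ord; move: T0; rewrite -lt0n; nia.
  case: TD => [TD|T0]; last by move=> J n _ _ _ x; case: (T0 x).
  suff Hgp (J : {set T'}) (n : T' -> K) : #|J| = d.+1 ->
      (forall i, i \notin J -> n i = 0) -> \sum_i n i *: v' e i = 0 ->
      forall i, n i = 0.
    move=> J n JD nJ nv; have [|J' JJ' J'D] := @superset_of_card _ J d.+1.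
      by rewrite JD TD.
    apply: (Hgp J') => // i iJ'; apply: nJ.
    by apply: contra iJ'; apply/fintype.subsetP.
  move=> JD nJ nv.
  pose f := [ffun k : 'I_d.+1 => enum_val (cast_ord (esym JD) k)].
  have fi : injective f.
    by move=> k l; rewrite !ffunE => /enum_val_inj/cast_ord_inj.
  pose x : 'rV[K]_d.+1 := \row_k n (f k).
  have xAG : x *m (A f + e *: G f) = 0.
    rewrite -[RHS]nv (bigID (mem J)) /= [X in _ = _ + X]big1 ?addr0; last first.
      by move=> i /nJ->; rewrite scale0r.
    rewrite big_enum_val /= mulmx_sum_row.
    rewrite (reindex (cast_ord JD)) /=; last first.
      by exists (cast_ord (esym JD)) => k _; rewrite ?cast_ordK ?cast_ordKV.
    apply: eq_bigr => k _.
    have fk : f (cast_ord JD k) = enum_val k by rewrite ffunE cast_ordK.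
    rewrite mxE fk; congr (_ *: _); apply/rowP => j.
    by rewrite !mxE fk mulrA.
  have x0 : x = 0.
    have : ~~ root (char_poly (B f)) e by apply: Hroot.
    rewrite -eigenvalue_root_char.
    apply: contraNeq => x0; apply/eigenvalueP; exists x => //.
    rewrite /B mulmxN mulmxA.
    move: xAG; rewrite mulmxDr -scalemxAr => /eqP; rewrite addr_eq0 => /eqP->.
    by rewrite mulNmx opprK -scalemxAl mulmxK// GU.
  move=> i; have [iJ|/nJ//] := boolP (i \in J).
  have := congr1 (fun y : 'rV_ _ => y 0 (cast_ord JD (enum_rank_in iJ i))) x0.
  by rewrite !mxE ffunE cast_ordK enum_rankK_in.
- move=> w i wi; apply: contrapT => /forallNP Hlt.
  have [[a0 ma0] mg] := Hm i.
  have Ha a : dot w (v' e (i, a)) < 0 by rewrite ltNge; apply/negP/Hlt.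
  have msE a : `|m i a| * s (i, a) = m i a.
    by rewrite /s /=; case: ltP => mi; [rewrite mulrN1 ltr0_norm ?opprK | rewrite mulr1 ger0_norm].
  have : \sum_a `|m i a| * dot w (v' e (i, a)) =
      \sum_a `|m i a| * dot w (v i).
    transitivity (\sum_a `|m i a| * dot w (v i) +
       e * dot w (\sum_a m i a *: g (i, a))); last by rewrite mg dot0r mulr0 addr0.
    rewrite dot_sumr mulr_sumr -big_split /=; apply: eq_bigr => a _.
    rewrite /v' dotDr !dotZr mulrDr; congr (_ + _).
    by rewrite -[in RHS]msE; rewrite !mulrA [_ * e]mulrC.
  have Hge : 0 <= \sum_a `|m i a| * dot w (v i).
    by apply: sumr_ge0 => a _; rewrite mulr_ge0.
  have Hlt' : \sum_a `|m i a| * dot w (v' e (i, a)) < 0.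
    rewrite (bigD1 a0)//= ltr_nwDl//.
      by rewrite pmulr_rlt0// normr_gt0.
    by apply: sumr_le0 => a _; rewrite mulr_ge0_le0// ltW.
  by move=> E; move: Hge; rewrite -E leNgt Hlt'.
Qed.

End Perturbation.

(** * Separation by hyperplanes through the origin *)

Section Separation.
Variable K : realFieldType.

(** Adjoin [w] itself, under the index [None]: the resulting vectors are dependent, and pairing with
    [w] shows that its coefficient is zero. *)
Lemma hyperplane_dependence D (I : finType) (J : {set I}) (p : I -> 'rV[K]_D) w :
    w != 0 -> (D <= #|J|)%N -> (forall i, i \in J -> dot w (p i) = 0) ->
  exists m : I -> K, [/\ forall i, i \notin J -> m i = 0,
    exists i, m i != 0 & \sum_i m i *: p i = 0].
Proof.
move=> w0 DJ pw.
have [|m [mJ [i mi] mp]] :=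
  @linear_dependence K D _ (None |: [set Some i | i in J]) (oapp p w).
  have nN : None \notin [set Some i | i in J] by apply/imsetP => -[].
  by rewrite cardsU1 nN card_imset ?add1n//; apply: Some_inj.
have sumE : m None *: w + \sum_i m (Some i) *: p i = 0.
  rewrite -[RHS]mp [in RHS](bigD1 None)//=; congr (_ + _).
  by rewrite [RHS](reindex_omap Some id)//=; [apply: eq_bigl => j; rewrite eqxx | case].
have mJ' j : j \notin J -> m (Some j) = 0.
  move=> jJ; apply: mJ; rewrite !inE /=; apply: contra jJ => /imsetP[k kJ [->//]].
have mN : m None = 0.
  have /(congr1 (dot w)) := sumE; rewrite dot0r dotDr dotZr dot_sumr big1 => [|j _].
    move=> /eqP; rewrite addr0 mulf_eq0 => /orP[/eqP//|].
    by rewrite gt_eqF// dot_gt0.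
  rewrite dotZr; have [/pw->|/mJ'->] := boolP (j \in J); by rewrite ?mulr0 ?mul0r.
exists (m \o Some); split => //=.
  by case: i mi => [i mi|]; [exists i | rewrite mN eqxx].
by move: sumE; rewrite mN scale0r add0r.
Qed.

Lemma card_hyperplane D (T : finType) (v : T -> 'rV[K]_D) w :
  general_position v -> w != 0 -> (#|[set x | (dot w (v x) == 0)%R]| < D)%N.
Proof.
move=> gp w0; rewrite ltnNge; apply/negP => /subset_of_card[J Jw JD].
have [|i /(fintype.subsetP Jw)|m [mJ [i]]] := @hyperplane_dependence D _ J v w w0.
- by rewrite JD.
- by rewrite inE => /eqP.
- by move=> mi mv; rewrite (gp J m _ mJ mv) ?JD// eqxx in mi.
Qed.

(** The hyperplane passes through the origin; [s i = true] puts [Z i] on its negative side. *)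
Definition separated_by D (T : finType) (v : T -> 'rV[K]_D) n
    (Z : 'I_n -> {set T}) (s : {ffun 'I_n -> bool}) :=
  exists u, forall i x, x \in Z i -> 0 < (-1) ^+ s i * dot u (v x).

Definition separated D (T : finType) (v : T -> 'rV[K]_D) n
    (Z : 'I_n -> {set T}) :=
  forall s, separated_by v Z s.

(** Segments replace convex hulls: they suffice to reach a zero of a functional and to move from one
    point of [A] to another. *)
Definition in_segment D (T : finType) (v : T -> 'rV[K]_D) (A : {set T}) p :=
  exists x y s, [/\ x \in A, y \in A, 0 <= s <= 1 & p = (1 - s) *: v x + s *: v y].

Lemma in_segment_point D (T : finType) (v : T -> 'rV[K]_D) (A : {set T}) x :
  x \in A -> in_segment v A (v x).
Proof.
move=> xA; exists x, x, 0; split; rewrite ?lexx ?ler01//.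
by rewrite subr0 scale1r scale0r addr0.
Qed.

(** Separate according to the signs of [m]: pairing with the normal makes every term nonnegative,
    and zero only if its coefficient is. *)
Lemma separated_independent D (T : finType) (v : T -> 'rV[K]_D) n
    (Z : 'I_n -> {set T}) (p : 'I_n -> 'rV[K]_D) (m : 'I_n -> K) :
    separated v Z -> (forall i, in_segment v (Z i) (p i)) ->
  \sum_i m i *: p i = 0 -> forall i, m i = 0.
Proof.
move=> Zsep pZ mp; have [u Hu] := Zsep [ffun i => m i < 0].
have up i : 0 < (-1) ^+ (m i < 0)%R * dot u (p i).
  have [x [y [s [xZ yZ /andP[s0 s1] ->]]]] := pZ i.
  have := Hu i x xZ; have := Hu i y yZ; rewrite ffunE dotDr !dotZr.
  by case: (_ < 0); rewrite ?expr1 ?expr0 => ? ?; nra.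
have : \sum_i `|m i| * ((-1) ^+ (m i < 0)%R * dot u (p i)) = 0.
  rewrite -[RHS](dot0r u) -mp dot_sumr; apply: eq_bigr => i _.
  by rewrite dotZr {3}(numEsign (m i)) mulrA [_ * `|_|]mulrC.
move=> /eqP; rewrite psumr_eq0; last by move=> i _; rewrite mulr_ge0// ltW.
move=> /allP Hz i; have := Hz i (mem_index_enum _).
by rewrite mulf_eq0 [X in _ || X]gt_eqF// orbF normr_eq0 => /eqP.
Qed.

(** A hyperplane crossing all sets would contain a segment point of each; [D] points of a hyperplane
    are dependent, against separation. *)
Lemma separated_uncrossed D (T : finType) (v : T -> 'rV[K]_D)
    (Z : 'I_D -> {set T}) w : separated v Z -> w != 0 ->
  exists i, (forall x, x \in Z i -> dot w (v x) < 0) \/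
            (forall x, x \in Z i -> 0 < dot w (v x)).
Proof.
move=> Zsep w0; apply: contrapT => /forallNP Hw.
have /choice[p Hp] : forall i, exists p, in_segment v (Z i) p /\ dot w p = 0.
  move=> i; have /not_orP[/existsNP[x] + /existsNP[y]] := Hw i.
  move=> /not_implyP[xZ /negP]; rewrite -leNgt => wx.
  move=> /not_implyP[yZ /negP]; rewrite -leNgt => wy.
  pose s := dot w (v x) / (dot w (v x) - dot w (v y)).
  have [xy|xy] := eqVneq (dot w (v x) - dot w (v y)) 0.
    by exists (v x); split; [exact: in_segment_point | lra].
  have xy0 : 0 < dot w (v x) - dot w (v y) by rewrite lt_def xy; lra.
  exists ((1 - s) *: v x + s *: v y); split.
    exists x, y, s; split => //; rewrite divr_ge0 ?ler_pdivrMr//; lra.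
  rewrite dotDr !dotZr /s; field.
  by rewrite subr_eq0 -subr_eq0.
have [||m [_ [i mi] mp]] := @hyperplane_dependence D _ [set: 'I_D] p w w0.
- by rewrite cardsT card_ord.
- by move=> i _; apply: (Hp i).2.
- rewrite (separated_independent Zsep _ mp) ?eqxx// in mi.
  by move=> j; apply: (Hp j).1.
Qed.

Lemma orthogonal_vector d (p : 'I_d -> 'rV[K]_d.+1) :
  exists2 u, u != 0 & forall j, dot u (p j) = 0.
Proof.
pose C := \matrix_j p j.
have : kermx C^T != 0.
  rewrite -mxrank_eq0 mxrank_ker -lt0n subn_gt0.
  exact: leq_ltn_trans (rank_leq_col _) _.
move=> /rowV0Pn[u /sub_kermxP uC u0]; exists u => // j.
have /(congr1 (fun x : 'rV_ _ => x 0 j)) := uC.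
by rewrite !mxE => <-; apply: eq_bigr => i _; rewrite !mxE.
Qed.

(* The hyperplane passes through centerpoints of all sets but the last, so both
   of its sides contain a fixed proportion of each of them; the sign of the
   normal is chosen according to the last set. *)
Lemma separation_step d (I T : finType) (v : T -> 'rV[K]_d.+1)
    (A : I -> {set T}) (m : K) (f : 'I_d.+1 -> I) s :
    general_position v -> injective f -> (d.+2 * d.+1).*2%:R <= m ->
    (forall i, m <= #|A i|%:R) ->
  exists A' : I -> {set T}, [/\ forall i, A' i \subset A i,
    forall i, d.+2.*2%:R^-1 * m <= #|A' i|%:R & separated_by v (A' \o f) s].
Proof.
move=> gp fi mM mA.
have /choice[p Hp] := fun k => centerpoint (A (f k)) v.
have [u u0 up] := orthogonal_vector (fun j : 'I_d => p (lift ord_max j)).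
(* One side of the hyperplane holds half of the last set, and d+2 is at least 2. *)
have [b Hb] : exists b : bool, (#|A (f ord_max)| <= d.+2 *
    #|[set x in A (f ord_max) | (0 <= (-1) ^+ b * dot u (v x))%R]|)%N.
  pose P b := [set x in A (f ord_max) | (0 <= (-1) ^+ b * dot u (v x))%R].
  have : (#|A (f ord_max)| <= #|P false| + #|P true|)%N.
    apply: leq_trans (leq_card_setU _ _).1; apply/subset_leq_card.
    apply/fintype.subsetP => x xA; rewrite !inE xA /= expr0 expr1 mul1r mulN1r.
    by rewrite oppr_ge0 le_total.
  case: (leqP #|P false| #|P true|) => ? ?; [exists true | exists false];
    by rewrite -/(P _); nia.
pose w : 'rV[K]_d.+1 := (-1) ^+ (b (+) s ord_max) *: u.
have w0 : w != 0 by rewrite scaler_eq0 signr_eq0.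
have wup (c : bool) x : (-1) ^+ c * dot w x = (-1) ^+ (c (+) (b (+) s ord_max)) * dot u x.
  by rewrite dotZl mulrA -signr_addb.
have Hside k : (#|A (f k)| <= d.+2 *
    #|[set x in A (f k) | (0 <= (-1) ^+ s k * dot w (v x))%R]|)%N.
  have [j ->|->] := unliftP ord_max k; last first.
    under eq_finset do rewrite wup addbC -addbA addbb addbF.
    exact: Hb.
  apply: leq_trans (Hp _ ((-1) ^+ s (lift ord_max j) *: w)) _.
  rewrite leq_mul2l; apply/orP; right; apply/subset_leq_card/fintype.subsetP => x.
  by rewrite !inE !dotZl up !mulr0.
(* Sets outside the range of [f] are kept unchanged. *)
pose A' i := [set x in A i | [forall k, (f k == i) ==>
   (0 < (-1) ^+ s k * dot w (v x))]].
exists A'; split.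
- by move=> i; apply/fintype.subsetP => x; rewrite inE => /andP[].
- move=> i; have [/existsP[k /eqP <-]|ni] := boolP [exists k, f k == i]; last first.
    rewrite (_ : A' i = A i).
      apply: le_trans (mA i).
      rewrite ler_piMl ?invf_le1 ?ler1n ?ltr0n//.
      by apply: le_trans mM; rewrite ler0n.
    apply/setP => x; rewrite inE andb_idr// => _; apply/forallP => k.
    by apply/implyP => fk; case/negP: ni; apply/existsP; exists k.
  (* Passing from the closed to the open side loses fewer than d+1 points, which the lower bound on
     [m] absorbs into a factor 2. *)
  have : (#|A (f k)| <= d.+2 * (#|A' (f k)| + d.+1))%N.
    apply: leq_trans (Hside k) _; rewrite leq_mul2l; apply/orP; right.
    apply: (@leq_trans #|A' (f k) :|: [set x | dot w (v x) == 0%R]|); last first.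
      apply: leq_trans (leq_card_setU _ _).1 _.
      by rewrite leq_add2l ltnW// card_hyperplane.
    apply/subset_leq_card/fintype.subsetP => x; rewrite !inE => /andP[-> /=].
    rewrite le_eqVlt eq_sym mulf_eq0 signr_eq0 /= => /orP[->|Hx]; rewrite ?orbT//.
    apply/orP; left; apply/forallP => k'; apply/implyP => /eqP/fi->//.
  have := mA (f k); rewrite -(ler_nat K) natrM natrD => mk Hk.
  have {mk Hk} := le_trans mk Hk.
  move: mM; rewrite -!muln2 !natrM => mM Hk.
  rewrite invfM -mulrA ler_pdivrMl ?ltr0n//.
  rewrite ler_pdivrMl ?ltr0n// mulrC.
  set N := #|_|%:R in Hk *; have : (0 : K) < d.+2%:R by rewrite ltr0n.
  move: d.+2%:R d.+1%:R mM Hk => a c; nra.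
- exists w => k x /=; rewrite inE => /andP[_ /forallP/(_ k)].
  by rewrite eqxx.
Qed.

Lemma separated_byS D (T : finType) (v : T -> 'rV[K]_D) n
    (Z Z' : 'I_n -> {set T}) s : (forall i, Z' i \subset Z i) ->
  separated_by v Z s -> separated_by v Z' s.
Proof.
move=> Z'Z [u Hu]; exists u => i x xZ; apply: Hu.
exact: (fintype.subsetP (Z'Z i)).
Qed.

(** [separation_step] is applied for every injection and sign pattern in turn; subsets stay
    separated, and the number of rounds depends on [d] and [I] only, so [r] and [M] serve all
    [T]. *)
Lemma homogenization d (I : finType) : exists r M : K, [/\ 0 < r, 0 < M &
  forall (T : finType) (v : T -> 'rV[K]_d.+1) (A : I -> {set T}) (m : K),
    general_position v -> M <= m -> (forall i, m <= #|A i|%:R) ->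
  exists A' : I -> {set T}, [/\ forall i, A' i \subset A i,
    forall i, r * m <= #|A' i|%:R &
    forall f : 'I_d.+1 -> I, injective f -> separated v (A' \o f)]].
Proof.
pose r0 : K := d.+2.*2%:R^-1; pose M0 : K := (d.+2 * d.+1).*2%:R.
have r0_gt0 : 0 < r0 by rewrite invr_gt0 ltr0n.
have r0_le1 : r0 <= 1 by rewrite invf_le1 ?ler1n ?ltr0n.
have M0_gt0 : 0 < M0 by rewrite ltr0n.
have main (s : seq ({ffun 'I_d.+1 -> I} * {ffun 'I_d.+1 -> bool}))
    (T : finType) (v : T -> 'rV[K]_d.+1) (A : I -> {set T}) (m : K) :
    general_position v -> M0 <= r0 ^+ size s * m -> (forall i, m <= #|A i|%:R) ->
  exists A' : I -> {set T}, [/\ forall i, A' i \subset A i,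
    forall i, r0 ^+ size s * m <= #|A' i|%:R &
    forall fs, fs \in s -> injective fs.1 -> separated_by v (A' \o fs.1) fs.2].
  elim: s A m => [|fs s IH] A m gp Mm mA.
    by exists A; split => // i; rewrite expr0 mul1r.
  have m0 : 0 < m by have := lt_le_trans M0_gt0 Mm; rewrite pmulr_rgt0 ?exprn_gt0.
  have [fi|fni] := pselect (injective fs.1); last first.
    have [||A' [A'A A'm HA']] := IH A (r0 * m) gp.
    + by rewrite mulrA -exprSr.
    + by move=> i; apply: le_trans (mA i); rewrite ger_pMl.
    exists A'; split => //; first by move=> i; rewrite /= exprSr -mulrA.
    by move=> gs; rewrite inE => /orP[/eqP->|]; [|exact: HA'].
  have [|A1 [A1A A1m HA1]] := separation_step fs.2 gp fi _ mA.
    by apply: le_trans Mm _; rewrite ger_pMl// exprn_ile1// ltW.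
  have [||A' [A'A A'm HA']] := IH A1 (r0 * m) gp.
  + by rewrite mulrA -exprSr.
  + exact: A1m.
  exists A'; split => //.
  + by move=> i; apply: subset_trans (A1A i).
  + by move=> i; rewrite /= exprSr -mulrA.
  + move=> gs; rewrite inE => /orP[/eqP-> _|]; last exact: HA'.
    by apply: separated_byS HA1 => i; apply: A'A.
pose s := enum {: {ffun 'I_d.+1 -> I} * {ffun 'I_d.+1 -> bool}}.
exists (r0 ^+ size s), (M0 / r0 ^+ size s).
split; rewrite ?divr_gt0 ?exprn_gt0// => T v A m gp Mm mA.
have [|A' [A'A A'm HA']] := main s T v A m gp _ mA.
  by rewrite mulrC -ler_pdivrMr// exprn_gt0.
exists A'; split => // f fi b.
have := HA' (finfun f, b); rewrite mem_enum => /(_ isT) /=.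
have fE : finfun f =1 f by move=> k; rewrite ffunE.
case=> [|u Hu]; first exact: eq_inj fi _.
by exists u => k x xA; apply: Hu; rewrite /= fE.
Qed.

End Separation.

(** * Pach's theorem for a point of given depth *)

(** Without index [i] the combination involves only d+1 separated sets, whose points are
    independent. *)
Lemma exchange_coefficients (K : realFieldType) d (T : finType)
    (v : T -> 'rV[K]_d.+1) (B : 'I_d.+2 -> {set T}) (p : 'I_d.+2 -> 'rV[K]_d.+1)
    (m : 'I_d.+2 -> K) :
    (forall f : 'I_d.+1 -> 'I_d.+2, injective f -> separated v (B \o f)) ->
    (forall l, in_segment v (B l) (p l)) -> \sum_l m l *: p l = 0 ->
  forall i, m i = 0 -> forall l, m l = 0.
Proof.
move=> Bsep pB mp i mi l.
have mp' : \sum_k m (lift i k) *: p (lift i k) = 0.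
  by rewrite -[RHS]mp (bigD1_ord i)//= mi scale0r add0r.
have := separated_independent (Bsep _ (@lift_inj _ i)) (fun k => pB (lift i k)) mp'.
by have [j ->|-> //] := unliftP i l.
Qed.

(** If the dependence of the new points, scaled to agree with [a] at [l], had a negative coefficient
    at [k], some mixture of the two would vanish at [k]. Agreement at [l] makes it a dependence with
    a point of the segment from [x l] to [y l], so all its coefficients vanish, although the one at
    [l] is positive. *)
Lemma zero_in_hull_exchange (K : realFieldType) d (T : finType)
    (v : T -> 'rV[K]_d.+1) (B : 'I_d.+2 -> {set T}) (x y : 'I_d.+2 -> T) l :
    (forall f : 'I_d.+1 -> 'I_d.+2, injective f -> separated v (B \o f)) ->
    (forall i, x i \in B i) -> (forall i, y i \in B i) ->
    (forall i, i != l -> x i = y i) ->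
  zero_in_hull [set: 'I_d.+2] (fun i => v (x i)) ->
  zero_in_hull [set: 'I_d.+2] (fun i => v (y i)).
Proof.
move=> Bsep xB yB xy [a [a0 _ a1 ax]].
have pt z : (forall i, z i \in B i) -> forall i, in_segment v (B i) (v (z i)).
  by move=> zB i; apply: in_segment_point.
have a_gt0 i : 0 < a i.
  rewrite lt_def a0 andbT; apply: contraTneq a1 => ai.
  by rewrite big1 ?ltxx// => j _; apply: exchange_coefficients Bsep (pt _ xB) ax i ai j.
have [|m [_ [i mi] my]] := linear_dependence (J := [set: 'I_d.+2]) (fun i => v (y i)).
  by rewrite cardsT card_ord.
have m_neq0 j : m j != 0.
  apply: contraNneq mi => mj.
  by apply/eqP; apply: exchange_coefficients Bsep (pt _ yB) my j mj i.
pose c := a l / m l; pose n j := c * m j.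
have nl : n l = a l by rewrite /n /c divfK.
have ny : \sum_j n j *: v (y j) = 0.
  under eq_bigr do rewrite -scalerA.
  by rewrite -scaler_sumr my scaler0.
have [n0|/existsNP[k /negP]] := pselect (forall j, 0 <= n j).
  exists n; split => // [j|]; first by rewrite inE.
  by rewrite (bigD1 l)//= nl ltr_pwDl// sumr_ge0.
rewrite -ltNge => nk.
have ak := a_gt0 k.
pose s := a k / (a k - n k).
have s01 : 0 <= s <= 1.
  have ank : 0 < a k - n k by lra.
  by rewrite /s divr_ge0 ?ler_pdivrMr//; lra.
pose b j := (1 - s) * a j + s * n j.
have bk : b k = 0.
  by rewrite /b /s; field; rewrite gt_eqF//; lra.
have bl : b l = a l by rewrite /b nl; ring.
pose p j := if j == l then (1 - s) *: v (x l) + s *: v (y l) else v (x j).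
have pB j : in_segment v (B j) (p j).
  rewrite /p; have [->|_] := eqVneq j l; last exact: in_segment_point.
  by exists (x l), (y l), s.
have bp : \sum_j b j *: p j = 0.
  transitivity ((1 - s) *: (\sum_j a j *: v (x j)) + s *: (\sum_j n j *: v (y j))).
    rewrite !scaler_sumr -big_split /=; apply: eq_bigr => j _.
    rewrite /p; have [->|jl] := eqVneq j l.
      by rewrite bl nl scalerDr !scalerA ![_ * a l]mulrC.
    by rewrite (xy _ jl) !scalerA -scalerDl.
  by rewrite ax ny !scaler0 addr0.
have := exchange_coefficients Bsep pB bp bk l.
by rewrite bl => /eqP; rewrite gt_eqF.
Qed.

Lemma zero_in_hull_transversals (K : realFieldType) d (T : finType)
    (v : T -> 'rV[K]_d.+1) (B : 'I_d.+2 -> {set T}) (x y : 'I_d.+2 -> T) :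
    (forall f : 'I_d.+1 -> 'I_d.+2, injective f -> separated v (B \o f)) ->
    (forall i, x i \in B i) -> (forall i, y i \in B i) ->
  zero_in_hull [set: 'I_d.+2] (fun i => v (x i)) ->
  zero_in_hull [set: 'I_d.+2] (fun i => v (y i)).
Proof.
move=> Bsep xB yB Hx; pose z n (i : 'I_d.+2) := if (i < n)%N then y i else x i.
have zB n i : z n i \in B i by rewrite /z; case: ifP.
suff Hz n : (n <= d.+2)%N -> zero_in_hull [set: 'I_d.+2] (fun i => v (z n i)).
  have := Hz _ (leqnn _); congr zero_in_hull; apply/funext => i.
  by rewrite /z ltn_ord.
elim: n => [|n IH] nd; first exact: Hx.
apply: (@zero_in_hull_exchange _ _ _ _ B (z n) _ (Ordinal nd)) => //; last exact/IH/ltnW.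
move=> i; rewrite /z -val_eqE /= => ni.
by rewrite ltnS [in RHS]leq_eqVlt (negPf ni).
Qed.

(* By induction on [t]: [d.+1] separated subsets of [X] are not all crossed by
   the hyperplane; either one of them lies in the half-space, or one lies in the
   complement and the half-space loses no point when that subset is removed. *)
Lemma halfspace_catching_family (K : realFieldType) d :
  exists r M : K, [/\ 0 < r, 0 < M & forall t : nat,
  exists I : finType, (d < #|I|)%N /\
  forall (T : finType) (v : T -> 'rV[K]_d.+1) (X : {set T}) (k : K),
    general_position v -> M <= k -> k <= #|X|%:R -> #|X|%:R <= k * (1 + t%:R * r) ->
  exists F : I -> {set T}, (forall i, r * k <= #|F i|%:R) /\
    forall w, w != 0 -> k <= #|[set x in X | dot w (v x) <= 0]|%:R ->
      exists i, forall x, x \in F i -> dot w (v x) <= 0].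
Proof.
have [r0 [M [r0_gt0 M0 Hh]]] := homogenization K d 'I_d.+1.
pose r := Num.min r0 1.
have r_gt0 : 0 < r by rewrite lt_min r0_gt0 ltr01.
have r_le1 : r <= 1 by rewrite ge_min lexx orbT.
exists r, M; split => //; elim=> [|t [I [dI IH]]].
  (* Here [X] has exactly [k] elements, so the half-space contains all of it. *)
  exists 'I_d.+1; rewrite card_ord; split => // T v X k gp Mk kX.
  rewrite mul0r addr0 mulr1 => Xk.
  have k0 : 0 < k := lt_le_trans M0 Mk.
  exists (fun=> X); split=> [i|w w0 kw]; first by rewrite (le_trans _ kX)// ger_pMl.
  exists ord0 => x xX.
  have /eqP XE : [set x in X | dot w (v x) <= 0] == X.
    rewrite eqEcard; apply/andP; split.
      by apply/fintype.subsetP => z; rewrite inE => /andP[].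
    by rewrite -(ler_nat K) (le_trans Xk).
  by move: xX; rewrite -XE inE => /andP[].
(* One member for each separated set, and one family for each complement of such a set in [X]. *)
exists ('I_d.+1 + 'I_d.+1 * I)%type; split.
  by rewrite card_sum card_ord leq_addr.
move=> T v X k gp Mk kX Xk.
have k0 : 0 < k := lt_le_trans M0 Mk.
have [//|Z [ZX Zk /(_ id (fun _ _ => id)) Zsep]] := Hh T v (fun=> X) k gp Mk.
have {}Zk i : r * k <= #|Z i|%:R.
  by apply: le_trans (Zk i); rewrite ler_pM2r// ge_min lexx.
have /choice[F HF] : forall i, exists F : I -> {set T},
    (forall j, r * k <= #|F j|%:R) /\
    forall w, w != 0 -> k <= #|[set x in X :\: Z i | dot w (v x) <= 0]|%:R ->
      exists j, forall x, x \in F j -> dot w (v x) <= 0.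
  move=> i; have [kY|Yk] := leP k #|X :\: Z i|%:R.
    apply: IH => //.
    have : #|X|%:R = #|Z i|%:R + #|X :\: Z i|%:R :> K.
      rewrite -natrD -(cardsID (Z i) X); congr (_ + _)%:R.
      by congr #|pred_of_set _|; apply/setIidPr/ZX.
    have := Zk i; rewrite -natr1 in Xk; move: Xk; nra.
  (* The complement has fewer than [k] points, so the claim is vacuous and [Z i] is a filler. *)
  exists (fun=> Z i); split => // w _ kw; move: Yk; rewrite ltNge => /negP[].
  apply: le_trans kw _; rewrite ler_nat.
  by apply/subset_leq_card/fintype.subsetP => z; rewrite inE => /andP[].
exists (fun i => match i with inl i => Z i | inr ij => F ij.1 ij.2 end).
split=> [[i|[i j]]|w w0 kw]; [exact: Zk | exact: (HF i).1 | ].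
have [i [wi|wi]] := separated_uncrossed Zsep w0.
  by exists (inl i) => x /wi/ltW.
have [|j Hj] := (HF i).2 w w0; last by exists (inr (i, j)).
apply: le_trans kw _; rewrite ler_nat; apply/subset_leq_card.
apply/fintype.subsetP => z; rewrite !inE => /andP[zX wz]; rewrite zX wz !andbT.
by apply: contraTN wz => /wi; rewrite ltNge.
Qed.

Lemma zero_in_hull_sub (K : realFieldType) D (I : finType) (J : {set I})
    (v : I -> 'rV[K]_D) n (h : 'I_n -> I) :
    (forall i, i \in J -> exists k, h k = i) -> injective h ->
  zero_in_hull J v -> zero_in_hull [set: 'I_n] (fun k => v (h k)).
Proof.
move=> hJ hi [l [l0 lJ l1 lv]].
have lh0 i : i \notin [set h k | k in 'I_n] -> l i = 0.
  move=> ih; apply: lJ; apply: contra ih => /hJ[k <-].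
  exact: imset_f.
have E (V : nmodType) (F : I -> V) : (forall i, l i = 0 -> F i = 0) ->
    \sum_k F (h k) = \sum_i F i.
  move=> F0; rewrite [RHS](bigID (mem [set h k | k in 'I_n])) /=.
  rewrite [X in _ + X]big1 ?addr0; last by move=> i /lh0/F0.
  by rewrite big_imset//=; apply: in2W.
exists (fun k => l (h k)); split => //.
- by move=> k; rewrite inE.
- by rewrite (E K l).
- by rewrite (E _ (fun i => l i *: v i))// => i ->; rewrite scale0r.
Qed.

(** [C] bounds the number of rounds of the half-space induction, hence the number of sets to be
    homogenized; so [c] and [M] do not depend on [T]. *)
Lemma pach_general_position (K : archiRealFieldType) d (C : K) :
  exists c M : K, [/\ 0 < c, 0 < M &
  forall (T : finType) (v : T -> 'rV[K]_d.+1) (X : {set T}) (k : K),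
    general_position v -> M <= k -> #|X|%:R <= C * k ->
    (forall w, k <= #|[set x in X | dot w (v x) <= 0]|%:R) ->
  exists A : 'I_d.+2 -> {set T}, (forall l, c * k <= #|A l|%:R) /\
    forall y : 'I_d.+2 -> T, (forall l, y l \in A l) ->
      zero_in_hull [set: 'I_d.+2] (fun l => v (y l))].
Proof.
have [r [M [r0 M0 Hfam]]] := halfspace_catching_family K d.
have [t Ct] : exists t : nat, C <= 1 + t%:R * r.
  exists (Num.bound `|C / r|); rewrite (@le_trans _ _ (C / r * r))//.
    by rewrite divfK ?gt_eqF.
  rewrite -[leLHS]add0r lerD// ler_pM2r//.
  exact: le_trans (ler_norm _) (ltW (archi_boundP (normr_ge0 _))).
have [I [dI HF]] := Hfam t.
have [r' [M' [r'0 M'0 Hh]]] := homogenization K d I.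
exists (r' * r), (Num.max M (M' / r)); split; rewrite ?mulr_gt0 ?lt_max ?M0//.
move=> T v X k gp; rewrite ge_max => /andP[Mk]; rewrite ler_pdivrMr// mulrC => M'k.
move=> XC depth; have k0 : 0 < k := lt_le_trans M0 Mk.
have [||F [Fk HFw]] := HF T v X k gp Mk.
- apply: le_trans (depth 0) _; rewrite ler_nat.
  by apply/subset_leq_card/fintype.subsetP => z; rewrite inE => /andP[].
- by apply: le_trans XC _; rewrite mulrC ler_pM2l.
have [A [AF Ak Asep]] := Hh T v F _ gp M'k Fk.
have {Ak}Ak i : r' * r * k <= #|A i|%:R by rewrite -mulrA.
have /choice[x xA] : forall i, exists x, x \in A i.
  move=> i; apply/set0Pn; rewrite -card_gt0 -(ltr_nat K).
  by apply: lt_le_trans (Ak i); rewrite !mulr_gt0.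
(* If [w] were positive on all the [v (x i)], the half-space where it is at most 0 would contain
   some [F i], hence [x i]. *)
have Hx : zero_in_hull [set: I] (fun i => v (x i)).
  have [//|[w Hw]] := gordan [set: I] (fun i => v (x i)).
  have [i0 _] : exists i0 : I, i0 \in I by apply/card_gt0P/(leq_trans _ dI).
  have w0 : w != 0.
    apply: contraTneq (Hw i0 (in_setT _)) => ->.
    by rewrite dotC dot0r ltxx.
  have [i Hi] := HFw w w0 (depth w).
  have := Hw i (in_setT _); rewrite ltNge => /negP[]; apply: Hi.
  exact: (fintype.subsetP (AF i)).
have [J [_ Jd HJ]] := caratheodory Hx.
(* Fewer than d+2 points would lie in d+1 separated sets and be independent. *)
have JE : #|J| = d.+2.
  apply/eqP; rewrite eqn_leq Jd /= ltnNge; apply/negP => Jd'.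
  have [|J' JJ' J'd] := @superset_of_card _ J d.+1; first by rewrite Jd'.
  pose f (i : 'I_d.+1) : I := enum_val (cast_ord (esym J'd) i).
  have fi : injective f by move=> a b /enum_val_inj/cast_ord_inj.
  have [|//|l [l0 _ l1 lv]] := @zero_in_hull_sub K d.+1 I J (fun i => v (x i)) _ f _ fi.
    move=> i /(fintype.subsetP JJ') iJ'.
    by exists (cast_ord J'd (enum_rank_in iJ' i)); rewrite /f cast_ordK enum_rankK_in.
  move: l1; rewrite big1 ?ltxx// => i _.
  apply: separated_independent (Asep f fi) _ lv i => j.
  by apply: in_segment_point; apply: xA.
pose g (l : 'I_d.+2) : I := enum_val (cast_ord (esym JE) l).
have gi : injective g by move=> a b /enum_val_inj/cast_ord_inj.
exists (A \o g); split=> [l|y yA]; first exact: Ak.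
apply: (@zero_in_hull_transversals _ _ _ _ (A \o g) (x \o g)) => //.
- by move=> f fi; apply: (Asep (g \o f)); apply: inj_comp.
- by move=> i; apply: xA.
- apply: (@zero_in_hull_sub K d.+1 I J (fun i => v (x i)) _ g _ gi) => // i iJ.
  by exists (cast_ord JE (enum_rank_in iJ i)); rewrite /g cast_ordK enum_rankK_in.
Qed.

(** Greedy choice: the sets chosen before occupy at most (|I| - 1) q points of the next one. *)
Lemma disjoint_subsets (I T : finType) (A : I -> {set T}) q :
    (forall i, #|I| * q <= #|A i|)%N ->
  exists A' : I -> {set T}, [/\ forall i, A' i \subset A i,
    forall i, #|A' i| = q & forall i j, i != j -> [disjoint A' i & A' j]].
Proof.
move=> Aq; suff H (J : {set I}) : exists A' : I -> {set T},
    [/\ forall i, A' i \subset A i, forall i, i \in J -> #|A' i| = q,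
        forall i, i \notin J -> A' i = set0
      & forall i j, i != j -> [disjoint A' i & A' j]].
  have [A' [A'A A'q _ A'd]] := H [set: I].
  by exists A'; split => // i; apply: A'q; rewrite inE.
have [n] := ubnP #|J|; elim: n => // n IH in J *; rewrite ltnS => Jn.
have [->|/set0Pn[j jJ]] := eqVneq J set0.
  exists (fun=> set0); split => // [i|i|i k _]; first exact: sub0set.
    by rewrite inE.
  by rewrite -setI_eq0 set0I.
have [|A' [A'A A'q A'0 A'd]] := IH (J :\ j).
  by rewrite (cardsD1 j) jJ in Jn.
pose U := \bigcup_(i in J :\ j) A' i.
have [|Y YA Yq] := @subset_of_card _ (A j :\: U) q.
  have Uq : (#|U| <= #|J :\ j| * q)%N.
    apply: leq_trans (card_bigcup_le _ _) _.
    by rewrite -sum_nat_const leq_sum// => i /A'q->.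
  have JI : (#|J :\ j|.+1 <= #|I|)%N.
    by have := cardsD1 j J; rewrite jJ add1n => <-; apply: max_card.
  have := Aq j; rewrite -(cardsID U (A j)) => Ajq.
  have : (#|A j :&: U| <= #|U|)%N by rewrite subset_leq_card// subsetIr.
  by nia.
have AY i : i != j -> [disjoint A' i & Y].
  move=> ij; have [iJ|iJ] := boolP (i \in J :\ j); last first.
    by rewrite A'0// -setI_eq0 set0I.
  rewrite disjoint_sym; apply: disjointWl YA _.
  rewrite disjoint_sym disjoints_subset setCD.
  by apply: subset_trans (subsetUr _ _); apply: (bigcup_sup i).
exists (fun i => if i == j then Y else A' i); split.
- move=> i; have [->|_] := eqVneq i j; last exact: A'A.
  exact: subset_trans YA (subsetDl _ _).
- move=> i iJ; have [//|ij] := eqVneq i j.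
  by rewrite A'q// !inE ij.
- move=> i iJ; have [E|ij] := eqVneq i j; first by rewrite E jJ in iJ.
  by rewrite A'0// inE negb_and iJ orbT.
- move=> i k; have [E|ij] := eqVneq i j; have [E'|kj] := eqVneq k j.
  + by rewrite E E' eqxx.
  + by move=> _; rewrite disjoint_sym AY.
  + by move=> _; rewrite AY.
  + exact: A'd.
Qed.

(* Pach's theorem for a point of depth [n]; the extraction of a subfamily of
   size O(n) is what makes the constant independent of [#|T|]. *)
Lemma pach_depth (K : archiRealFieldType) d :
  exists2 c : K, 0 < c &
  forall (T : finType) (v : T -> 'rV[K]_d.+1) n, (d.+2 <= #|T|)%N -> (0 < n)%N ->
    (forall w, n <= #|[set i | (0 <= dot w (v i))%R]|)%N ->
  exists A : 'I_d.+2 -> {set T},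
    [/\ forall l l', l != l' -> [disjoint A l & A l'],
        forall l, c * n%:R <= #|A l|%:R &
        forall y : 'I_d.+2 -> T, (forall l, y l \in A l) ->
          zero_in_hull [set: 'I_d.+2] (fun l => v (y l))].
Proof.
pose D : K := d.+2%:R; have D0 : 0 < D by rewrite ltr0n.
(* At most (d+2) k extracted vectors with d+2 copies each: hence the factor [D ^+ 2]. *)
have [c [M [c0 M0 Hgp]]] := @pach_general_position K d (D ^+ 2).
pose c1 := c / D ^+ 2; have c1_gt0 : 0 < c1 by rewrite divr_gt0 ?exprn_gt0.
pose M1 := Num.max M c1^-1.
have M1_gt0 : 0 < M1 by rewrite lt_max M0.
(* The first term serves large [n]; the second makes [c2 * n%:R] at most 1 when single points are
   chosen. *)
pose c2 := Num.min (c1 / (2 * D)) (D * M1)^-1.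
exists c2; first by rewrite lt_min invr_gt0 !(divr_gt0, mulr_gt0, ltr0n).
(* [k] is n/(d+2) rounded up, the largest number of rounds that [extraction] allows. *)
move=> T v n dT n0 depth; pose k := ((n + d.+1) %/ d.+2)%N.
have nk : (n <= d.+2 * k)%N.
  have := ltn_ceil (n + d.+1) (ltn0Sn d.+1).
  by rewrite -/k mulSn [(k * _)%N]mulnC; move: (d.+2 * k)%N; lia.
have kn : (d.+2 * k < n + d.+2)%N.
  by have := leq_divM (n + d.+1) d.+2; rewrite -/k mulnC; move: (d.+2 * k)%N; lia.
have nkK : n%:R <= D * k%:R by rewrite -natrM ler_nat.
have [kM|Mk] := ltP k%:R M1.
  have c2n : c2 * n%:R <= 1.
    have DM0 : 0 < D * M1 by rewrite mulr_gt0.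
    apply: (@le_trans _ _ ((D * M1)^-1 * n%:R)).
      by rewrite ler_wpM2r ?ler0n// ge_min lexx orbT.
    rewrite ler_pdivrMl// mulr1 (le_trans nkK)// ler_pM2l//.
    exact: ltW.
  have [H|[w Hw]] := gordan [set: T] v; last first.
    have := leq_trans n0 (depth (- w)).
    rewrite card_gt0 => /set0Pn[i]; rewrite inE dotNl oppr_ge0 leNgt.
    by rewrite Hw ?inE.
  have [J [_ Jd HJ]] := caratheodory H.
  have [|J' JJ' J'd] := @superset_of_card _ J d.+2; first by rewrite Jd.
  pose h (l : 'I_d.+2) : T := enum_val (cast_ord (esym J'd) l).
  have hi : injective h by move=> a b /enum_val_inj/cast_ord_inj.
  exists (fun l => [set h l]); split.
  - by move=> l l' ll'; rewrite disjoints1 inE (inj_eq hi).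
  - by move=> l; rewrite cards1.
  - move=> y yh; have -> : (fun l => v (y l)) = (fun l => v (h l)).
      by apply/funext => l; have := yh l; rewrite inE => /eqP->.
    apply: zero_in_hull_sub HJ => // i /(fintype.subsetP JJ') iJ'.
    by exists (cast_ord J'd (enum_rank_in iJ' i)); rewrite /h cast_ordK enum_rankK_in.
have [W [Wk Wdepth]] := extraction depth kn.
have [v' [gp vdepth Hv']] := perturbation v d.+2.
pose X := setX W [set: 'I_d.+2].
have [||w|A [Ak HA]] := Hgp _ v' X k%:R gp.
- by apply: le_trans Mk; rewrite le_max lexx.
- rewrite cardsX cardsT card_ord -natrX -natrM ler_nat.
  by rewrite expnS expn1 -mulnA mulnC leq_mul2l Wk orbT.
- rewrite ler_nat; apply: leq_trans (Wdepth (- w)) _.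
  apply: leq_trans (leq_imset_card fst _); apply/subset_leq_card.
  apply/fintype.subsetP => i; rewrite inE => /andP[iW].
  move=> /vdepth[a ia]; apply/imsetP; exists (i, a) => //.
  by rewrite !inE /= iW -oppr_ge0 -dotNl.
(* Forgetting which copy was chosen costs a factor d+2 and may make the sets overlap; disjointness
   costs another d+2, whence [c1]. *)
pose B l := [set x.1 | x in A l].
have AB l : (#|A l| <= #|B l| * d.+2)%N.
  rewrite -[X in (_ * X)%N](card_ord d.+2) -cardsT -cardsX.
  apply/subset_leq_card/fintype.subsetP => x xA.
  by rewrite !inE andbT imset_f.
pose q := Num.truncn (c1 * k%:R).
have ck_ge0 : 0 <= c1 * k%:R by rewrite mulr_ge0// ltW.
have /andP[qck ckq] := truncn_itv ck_ge0; rewrite -/q in qck ckq.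
have q1 : (0 < q)%N.
  rewrite lt0n; apply/eqP => q0; move: ckq; rewrite q0 ltNge => /negP[].
  rewrite -ler_pdivrMl// mulr1.
  by apply: le_trans Mk; rewrite le_max lexx orbT.
have [l|B' [B'B B'q B'd]] := @disjoint_subsets _ _ B q.
  rewrite card_ord -(@leq_pmul2r d.+2)//; apply: leq_trans (AB l).
  rewrite -(ler_nat K); apply: le_trans (Ak l).
  rewrite !natrM -/D mulrAC -expr2 mulrC -ler_pdivlMr ?exprn_gt0//.
  by rewrite mulrAC.
exists B'; split => // [l|y yB].
  rewrite B'q; apply: (@le_trans _ _ (c1 / (2 * D) * n%:R)).
    by rewrite ler_wpM2r ?ler0n// ge_min lexx.
  rewrite mulrAC ler_pdivrMr ?mulr_gt0//.
  have q1K : 1 <= q%:R :> K by rewrite ler1n.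
  have : c1 * n%:R <= c1 * (D * k%:R) by rewrite ler_pM2l.
  have : D * (c1 * k%:R) <= D * (2 * q%:R).
    by rewrite ler_pM2l// -natr1 in ckq *; lra.
  by lra.
have /choice[z Hz] : forall l, exists z, z \in A l /\ z.1 = y l.
  by move=> l; have /(fintype.subsetP (B'B l))/imsetP[z zA ->] := yB l; exists z.
have := Hv' (finfun z).
rewrite (_ : (fun i => v _) = (fun l => v (y l))); last first.
  by apply/funext => l; rewrite ffunE (Hz l).2.
apply; rewrite (_ : (fun i => v' _) = (fun l => v' (z l))); last first.
  by apply/funext => l; rewrite ffunE.
by apply: HA => l; apply: (Hz l).1.
Qed.

From mathcomp Require Import finmap.
From mathcomp Require Import classical_sets reals convex.
From mathcomp Require Import interval_inference.

Local Open Scope classical_set_scope.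
Local Open Scope ring_scope.

(** * Bichromatic point sets *)

(** Convexity is a binary condition, so the mean is built one point at a time; a tail of weight zero
    is treated apart, since it cannot be normalized. *)
Lemma convex_set_sum (K : realType) (V : lmodType K) (C : set V) n
    (r : 'I_n -> V) (m : 'I_n -> K) :
    @convex_set K V C -> (forall i, C (r i)) -> (forall i, 0 <= m i) ->
  0 < \sum_i m i -> C ((\sum_i m i)^-1 *: \sum_i m i *: r i).
Proof.
move=> Cconv; elim: n r m => [|n IH] r m rC m0.
  by rewrite big_ord0 ltxx.
rewrite !big_ord_recl /=; set S := \sum_(i < n) _; set q := \sum_(i < n) _.
have S0 : 0 <= S by apply: sumr_ge0.
have [S0E|Sn0] := eqVneq S 0.
  rewrite /q big1 => [|i _]; last first.
    have /eqP := S0E; rewrite psumr_eq0// => /allP/(_ i (mem_index_enum _))/eqP->.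
    by rewrite scale0r.
  rewrite S0E !addr0 => m_gt0.
  by rewrite scalerA mulVf ?gt_eqF// scale1r.
move=> m_gt0; have S_gt0 : 0 < S by rewrite lt_def Sn0.
have Cq : C (S^-1 *: q) by apply: IH => // i; apply: rC.
pose t := m ord0 / (m ord0 + S).
have t0 : 0 <= t by rewrite divr_ge0// ltW.
have t1 : t <= 1 by rewrite ler_pdivrMr// mul1r lerDl.
have := Cconv (r ord0) (S^-1 *: q) (Itv01 t0 t1).
rewrite !inE => /(_ (rC _) Cq); congr C.
rewrite /conv /= /t scalerDr !scalerA [_^-1 * m ord0]mulrC; congr (_ + _ *: _).
by rewrite /unstable.onem; field; rewrite !gt_eqF.
Qed.

Lemma card_fset_sub (V : choiceType) (A : {fset V}) (P : pred V) :
  #|` [fset x in A | P x]%fset| = #|[set a : A | P (val a)]%SET|.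
Proof.
have -> : [fset x in A | P x]%fset = [fset val a | a in [set a : A | P (val a)]%SET]%fset.
  apply/fsetP => x; rewrite !inE /=; apply/andP/imfsetP => [[xA Px]|[a /=]].
    by exists [` xA]%fset; rewrite ?inE.
  by rewrite inE => Pa ->; rewrite Pa fsvalP.
by rewrite card_imfset /= ?cardE//; apply: val_inj.
Qed.

Lemma card_set_sum (A B : finType) (P : pred (A + B)) :
  (#|[set i | P i]%SET| = #|[set a | P (inl a)]%SET| + #|[set b | P (inr b)]%SET|)%N.
Proof. by rewrite -!sum1dep_card big_sumType. Qed.

(** Red points not counted on the right lie in the half-space where [s + dot u] is at most 0, which
    holds at least as many blue points as red ones. *)
Lemma surrounds_depth (K : realType) d (R B : {fset 'rV[K]_d}) :
    (1 <= d)%N -> surrounds B R -> forall (u : 'rV[K]_d) (s : K),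
  (#|` R| <= #|[set r : R | (0 <= s + dot u (val r))%R]%SET| +
     #|[set b : B | (s + dot u (val b) <= 0)%R]%SET|)%N.
Proof.
move=> d1 BR u s.
(* A half-space large enough to contain [R] gives this; it settles the case [u = 0], where no
   half-space is defined. *)
have RB : (#|` R| <= #|` B|)%N.
  pose u1 : 'rV[K]_d := const_mx 1; pose t := \sum_(r : R) `|dot u1 (val r)|.
  pose h := [set x : 'rV[K]_d | \sum_(i < d) u1 0 i * x 0 i <= t].
  have hh : closed_halfspace h.
    exists u1, t; split => //.
    by apply/eqP => /rowP/(_ (Ordinal d1))/eqP; rewrite !mxE oner_eq0.
  have RE : [fset x in R | x \in h]%fset = R.
    apply/fsetP => x; rewrite !inE andb_idr// => xR.
    suff xt : dot u1 x <= t by rewrite inE.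
    rewrite (le_trans (ler_norm _))// /t.
    by rewrite (bigD1 [` xR]%fset)//= lerDl sumr_ge0.
  rewrite -{1}RE; apply: leq_trans (BR h hh) _.
  exact/fsubset_leq_card/fset_sub.
have [->|u0] := eqVneq u 0.
  have dot0 x : dot 0 x = 0 :> K by rewrite dotC dot0r.
  have [s0|s0] := leP 0 s.
    rewrite [X in (_ <= X + _)%N](_ : _ = #|` R|) ?leq_addr// cardfE -cardsT.
    by congr #|pred_of_set _|; apply/setP => r; rewrite !inE dot0 addr0 s0.
  apply: leq_trans RB _.
  rewrite [X in (_ <= _ + X)%N](_ : _ = #|` B|) ?leq_addl// [RHS]cardfE -cardsT.
  by congr #|pred_of_set _|; apply/setP => r; rewrite !inE dot0 addr0 ltW.
pose h := [set x : 'rV[K]_d | \sum_(i < d) u 0 i * x 0 i <= - s].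
have := BR h (ex_intro _ u (ex_intro _ (- s) (conj u0 erefl))).
rewrite !card_fset_sub => hRB.
have hE (A : {fset 'rV[K]_d}) : [set a : A | val a \in h]%SET =
    [set a : A | s + dot u (val a) <= 0]%SET.
  apply/setP => a; rewrite !inE addrC -lerBrDr sub0r.
  by apply/idP/idP; rewrite inE.
rewrite !hE in hRB; apply: leq_trans (leq_add (leqnn _) hRB).
rewrite cardfE -cardsT; apply: leq_trans (leq_card_setU _ _).1.
by apply/subset_leq_card/fintype.subsetP => r _; rewrite !inE le_total.
Qed.

Lemma dot_row_mx (K : realType) m n (w : 'rV[K]_(m + n)) x y :
  dot w (row_mx x y) = dot (lsubmx w) x + dot (rsubmx w) y.
Proof.
rewrite /dot big_split_ord /=; congr (_ + _); apply: eq_bigr => i _.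
  by rewrite row_mxEl mxE.
by rewrite row_mxEr mxE.
Qed.

Theorem mainTheorem4 (K : realType) (d : nat) (d_ge1 : (1 <= d)%N) :
  exists c2 : K, 0 < c2 /\
    forall R B : {fset 'rV[K]_d},
      [disjoint R & B]%fset ->
      (R != fset0 -> (d + 2 <= #|` (R `|` B)%fset|)%N) ->
      surrounds B R ->
      exists (a b : nat) (R_ : 'I_a -> {fset 'rV[K]_d})
             (B_ : 'I_b -> {fset 'rV[K]_d}),
        (forall i, (R_ i `<=` R)%fset) /\
        (forall j, (B_ j `<=` B)%fset) /\
        (forall i i', i != i' -> [disjoint R_ i & R_ i']%fset) /\
        (forall j j', j != j' -> [disjoint B_ j & B_ j']%fset) /\
        (forall i j, [disjoint R_ i & B_ j]%fset) /\
        (a + b = d + 2)%N /\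
        (forall i, c2 * #|` R|%:R <= #|` R_ i|%:R) /\
        (forall j, c2 * #|` R|%:R <= #|` B_ j|%:R) /\
        (forall (r : 'I_a -> 'rV[K]_d) (b' : 'I_b -> 'rV[K]_d),
           (forall i, r i \in R_ i) -> (forall j, b' j \in B_ j) ->
           convex_hull (range r) `&` convex_hull (range b') !=set0).
Proof.
have [c c0 Hc] := pach_depth K d.
(* Each set keeps its majority colour, at least half of it. *)
exists (c / 2); split; first by rewrite divr_gt0.
move=> R B RB dRB BR; have [R0|R0] := eqVneq R fset0.
  (* Empty sets admit no choice of points, so the last condition is vacuous. *)
  exists (d + 2)%N, 0%N, (fun=> fset0), (fun=> fset0).
  rewrite R0 cardfs0 mulr0 addn0; split; first by move=> *; apply: fsub0set.
  split; first by move=> *; apply: fsub0set.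
  split; first by move=> *; apply: fdisjoint0X.
  split; first by move=> *; apply: fdisjoint0X.
  split; first by move=> *; apply: fdisjoint0X.
  do 3![split; first by move=> *; rewrite ?ler0n].
  by rewrite addn2 => r b' /(_ ord0); rewrite inE.
have {dRB} := dRB R0.
rewrite cardfsU (eqP RB) cardfs0 subn0 => dRB.
pose T : finType := (R + B)%type.
pose v (t : T) : 'rV[K]_(1 + d) := match t with
  | inl r => row_mx (const_mx 1) (val r)
  | inr b => - row_mx (const_mx 1) (val b) end.
have dot_const (s : 'rV[K]_1) : dot s (const_mx 1) = s 0 0.
  by rewrite /dot big_ord1 mxE mulr1.
have depth w : (#|` R| <= #|[set i | (0 <= dot w (v i))%R]%SET|)%N.
  rewrite card_set_sum /=.
  apply: leq_trans (surrounds_depth d_ge1 BR (rsubmx w) (lsubmx w 0 0)) _.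
  apply: leq_add; apply/subset_leq_card/fintype.subsetP => x; rewrite !inE.
    by rewrite dot_row_mx dot_const.
  by rewrite dotNr dot_row_mx dot_const oppr_ge0.
have [||A [Ad Ac HA]] := Hc T v #|` R| _ _ depth.
- by rewrite card_sum -!cardfE -addn2.
- by rewrite cardfs_gt0.
pose RA l := [fset val r | r in [set r : R | inl r \in A l]%SET]%fset.
pose BA l := [fset val b | b in [set b : B | inr b \in A l]%SET]%fset.
have RAP l x : reflect (exists2 r : R, inl r \in A l & x = val r) (x \in RA l).
  by apply: (iffP (imfsetP _ _ _ _)) => -[r /=]; rewrite ?inE => rA ->; exists r; rewrite ?inE.
have BAP l x : reflect (exists2 r : B, inr r \in A l & x = val r) (x \in BA l).
  by apply: (iffP (imfsetP _ _ _ _)) => -[r /=]; rewrite ?inE => rA ->; exists r; rewrite ?inE.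
have Acard l : (#|A l| = #|` RA l| + #|` BA l|)%N.
  rewrite !card_imfset /= -?cardE; [|exact: val_inj..].
  by rewrite -(card_set_sum (mem (A l))); congr #|pred_of_set _|; apply/setP => x; rewrite inE.
pose col := [set l | (#|` BA l| <= #|` RA l|)%N]%SET.
have Rcol l : l \in col -> c / 2 * #|` R|%:R <= #|` RA l|%:R.
  rewrite inE -(ler_nat K) => BlR; have := Ac l; rewrite Acard natrD; lra.
have Bcol l : l \in (~: col)%SET -> c / 2 * #|` R|%:R <= #|` BA l|%:R.
  rewrite !inE -ltnNge => /ltnW; rewrite -(ler_nat K) => RlB.
  by have := Ac l; rewrite Acard natrD; lra.
exists #|col|, #|~: col|%SET, (fun i => RA (enum_val i)), (fun j => BA (enum_val j)).
have Adisj l l' x : l != l' -> x \in A l -> x \in A l' -> False.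
  by move=> ll' xl xl'; have /pred0P/(_ x) := Ad l l' ll'; rewrite /= xl xl'.
split; first by move=> i; apply/fsubsetP => x /RAP[r _ ->]; apply: fsvalP.
split; first by move=> i; apply/fsubsetP => x /BAP[r _ ->]; apply: fsvalP.
split.
  move=> i i' ii'; apply/fdisjointP => x /RAP[r rA ->]; apply/negP => /RAP[r' r'A].
  move=> /val_inj E; rewrite -E in r'A.
  by apply: (Adisj _ _ _ _ rA r'A); apply: contra ii' => /eqP/enum_val_inj->.
split.
  move=> i i' ii'; apply/fdisjointP => x /BAP[r rA ->]; apply/negP => /BAP[r' r'A].
  move=> /val_inj E; rewrite -E in r'A.
  by apply: (Adisj _ _ _ _ rA r'A); apply: contra ii' => /eqP/enum_val_inj->.
split.
  move=> i j; apply/fdisjointP => x /RAP[r _ ->]; apply/negP => /BAP[b _ E].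
  by have /fdisjointP/(_ _ (fsvalP r)) := RB; rewrite [fsval r]E fsvalP.
split; first by rewrite cardsC card_ord addn2.
split; first by move=> i; apply/Rcol/enum_valP.
split; first by move=> j; apply/Bcol/enum_valP.
move=> r b rR bB.
(* Each index has one colour, so one of the two clauses is vacuous. *)
have /choice[y Hy] : forall l, exists t, [/\ t \in A l,
    forall i, enum_val i = l -> v t = row_mx (const_mx 1) (r i) &
    forall j, enum_val j = l -> v t = - row_mx (const_mx 1) (b j)].
  move=> l; have [lc|lc] := boolP (l \in col).
    have /RAP[x xA xE] := rR (enum_rank_in lc l).
    exists (inl x); split.
    - by rewrite enum_rankK_in in xA.
    - move=> i il; rewrite /v -xE; congr (row_mx _ (r _)).
      by apply: enum_val_inj; rewrite enum_rankK_in.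
    - by move=> j jl; have := enum_valP j; rewrite jl inE lc.
  have lc' : l \in (~: col)%SET by rewrite inE.
  have /BAP[x xA xE] := bB (enum_rank_in lc' l).
  exists (inr x); split.
  - by rewrite enum_rankK_in in xA.
  - by move=> j jl; have := enum_valP j; rewrite jl (negPf lc).
  - move=> i il; rewrite /v -xE; congr (- row_mx _ (b _)).
    by apply: enum_val_inj; rewrite enum_rankK_in.
have [m [m0 _ m1 mv]] := HA y (fun l => let: And3 H _ _ := Hy l in H).
have splitE (V : nmodType) (F : 'I_d.+2 -> V) : \sum_l F l =
    \sum_(i < #|col|) F (enum_val i) + \sum_(j < #|~: col|%SET) F (enum_val j).
  rewrite (bigID (mem col)) /=; congr (_ + _); first by rewrite big_enum_val.
  transitivity (\sum_(l in (~: col)%SET) F l); last by rewrite big_enum_val.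
  by apply: eq_bigl => l; rewrite finset.in_setC.
(* The first coordinate gives equal total weights on the two sides, the others a common weighted
   sum. *)
have {}mv : \sum_(i < #|col|) m (enum_val i) *: row_mx (const_mx 1 : 'rV_1) (r i) =
    \sum_(j < #|~: col|%SET) m (enum_val j) *: row_mx (const_mx 1) (b j).
  apply/eqP; rewrite -subr_eq0 -[X in _ == X]mv splitE -sumrN; apply/eqP.
  congr (_ + _); apply: eq_bigr => i _.
    by have [_ /(_ i erefl) <- _] := Hy (enum_val i).
  by have [_ _ /(_ i erefl) ->] := Hy (enum_val i); rewrite scalerN.
have mE : \sum_(i < #|col|) m (enum_val i) = \sum_(j < #|~: col|%SET) m (enum_val j).
  have /(congr1 (fun x => lsubmx x 0 0)) := mv; rewrite !mxE !summxE.
  by under eq_bigr do rewrite mxE row_mxEl mxE mulr1;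
     under [X in _ = X -> _]eq_bigr do rewrite mxE row_mxEl mxE mulr1.
have rE : \sum_(i < #|col|) m (enum_val i) *: r i =
    \sum_(j < #|~: col|%SET) m (enum_val j) *: b j.
  apply/rowP => k; have /(congr1 (fun x => rsubmx x 0 k)) := mv.
  rewrite !mxE !summxE.
  under eq_bigr do rewrite mxE row_mxEr.
  under [X in _ = X -> _]eq_bigr do rewrite mxE row_mxEr.
  by under [X in _ -> X = _]eq_bigr do rewrite mxE;
     under [X in _ -> _ = X]eq_bigr do rewrite mxE.
have S0 : 0 < \sum_(i < #|col|) m (enum_val i).
  by move: m1; rewrite splitE -mE; lra.
exists ((\sum_(i < #|col|) m (enum_val i))^-1 *:
  \sum_(i < #|col|) m (enum_val i) *: r i); split.
  by move=> C [Cconv rC]; apply: convex_set_sum => // i; apply: rC; exists i.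
rewrite rE mE in S0 *; move=> C [Cconv bC].
by apply: convex_set_sum => // i; apply: bC; exists i.
Qed.
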